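(* For every odd integer $n\geq 4$ (that is, every odd $n\geq 5$), the 3-path-connectivity of the augmented cube $AQ_n$ is $$\pi_3(AQ_n)=\frac{3(n-1)}{2}-1 .$$
   Context: Path-connectivity. Let $G=(V,E)$ be a connected simple graph and let $D\subseteq V$ with $|D|\geq 2$. A path $P$ in $G$ is called a $D$-path if all the vertices of $D$ lie on $P$. A collection of $D$-paths $P_1,\dots,P_m$ is a set of internally disjoint $D$-paths if for all $1\leq i\neq j\leq m$ one has $V(P_i)\cap V(P_j)=D$ and $E(P_i)\cap E(P_j)=\emptyset$. Let $\pi_G(D)$ be the maximum number of internally disjoint $D$-paths in $G$. For an integer $k$ with $2\leq k\leq |V(G)|$, the $k$-path-connectivity of $G$ is $\pi_k(G)=\min\{\pi_G(D) \mid D\subseteq V(G),\ |D|=k\}$. Augmented cube. The augmented cube $AQ_n$ of dimension $n$ is a graph with vertex set $\{x_1x_2\dots x_n \mid x_i\in\{0,1\},\ 1\leq i\leq n\}$, so it has $2^n$ vertices. $AQ_1=K_2$ is the complete graph on two vertices. For $n\geq 2$, $AQ_n$ is constructed recursively from two disjoint copies $AQ_{n-1}^0$ and $AQ_{n-1}^1$ of $AQ_{n-1}$, whose vertices are prefixed by $0$ and $1$ respectively: $V(AQ_n)=V(AQ_{n-1}^0)\cup V(AQ_{n-1}^1)$, and the edges of $AQ_n$ are all edges within $AQ_{n-1}^0$ and within $AQ_{n-1}^1$, together with, for each vertex $x=0x_1x_2\dots x_{n-1}\in V(AQ_{n-1}^0)$, the hypercubic edge joining $x$ to $1x_1x_2\dots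 x_{n-1}$ and the complementary edge joining $x$ to $1\overline{x_1x_2\dots x_{n-1}}$, where $\overline{x_1x_2\dots x_{n-1}}$ denotes the bitwise complement of $x_1x_2\dots x_{n-1}$. *)

(* Defs.v *)
(* MathComp. A simple graph is given by its adjacency relation [e : rel T] on a
   finite vertex type [T], symmetric and irreflexive; vertex and edge sets of a
   path are finite sets, an edge being the unordered pair [set x; y]. *)
From mathcomp Require Import all_boot.

Set Implicit Arguments.
Unset Strict Implicit.
Unset Printing Implicit Defensive.

Section PathConnectivity.

Variables (T : finType) (e : rel T).

Definition is_path (p : seq T) : bool := [&& p != [::], uniq p & sorted e p].

Definition path_vertices (p : seq T) : {set T} := [set x in p].

Definition path_edges (p : seq T) : {set {set T}} :=
  [set [set u.1; u.2] | u in zip p (behead p)].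

Definition is_Dpath (D : {set T}) (p : seq T) : bool :=
  is_path p && (D \subset path_vertices p).

(* A path repeats no vertex, hence has at most #|T| vertices; using sequences
   of bounded size loses no path and makes collections of paths finite sets.
   A path and its reversal are different sequences, but they have the same
   edges, so for #|D| >= 2 no collection below contains both. *)
Definition internally_disjoint_Dpaths (D : {set T})
    (S : {set #|T|.-bseq T}) : bool :=
  [forall P in S, is_Dpath D P] &&
  [forall P in S, forall Q in S, (P != Q) ==>
     (path_vertices P :&: path_vertices Q == D) &&
     (path_edges P :&: path_edges Q == set0)].

Definition pi_set (D : {set T}) : nat :=
  \max_(S : {set #|T|.-bseq T} | internally_disjoint_Dpaths D S) #|S|.

(* The neutral element of the iterated minimum is the largest of the values
   involved, so that it does not affect the minimum as soon as k <= #|T|. *)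
Definition path_connectivity (k : nat) : nat :=
  \big[minn/(\max_(D : {set T} | #|D| == k) pi_set D)]_(D : {set T} | #|D| == k)
     pi_set D.

Lemma path_connectivity_min (k : nat) : k <= #|T| ->
  (exists2 D : {set T}, #|D| = k & path_connectivity k = pi_set D) /\
  (forall D : {set T}, #|D| = k -> path_connectivity k <= pi_set D).
Proof.
move=> le_kT; split; last first.
  move=> D /eqP cD; rewrite /path_connectivity.
  move: (\max_(_ | _) _) => m.
  have: D \in index_enum {set T} by rewrite mem_index_enum.
  elim: (index_enum _) => //= E s IHs; rewrite inE big_cons.
  case/orP => [/eqP <-|/IHs le_sD]; first by rewrite cD geq_minl.
  by case: ifP => // _; rewrite geq_min le_sD orbT.
have [D0 cD0] : exists D : {set T}, #|D| == k.
  exists [set x in take k (enum T)].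
  rewrite cardsE (card_uniqP _) ?take_uniq ?enum_uniq //.
  by rewrite size_takel // -cardE.
apply: (big_ind (fun v => exists2 D : {set T}, #|D| = k & v = pi_set D)).
- have [|D cD ->] := @eq_bigmax_cond _ [pred D : {set T} | #|D| == k] pi_set.
    by apply/card_gt0P; exists D0.
  by exists D => //; apply/eqP.
- by move=> a b ha hb; rewrite /minn; case: ifP.
- by move=> E /eqP cE; exists E.
Qed.

End PathConnectivity.

(* Vertices are bit strings of length n, the first bit selecting one of the two
   copies of the cube of dimension n - 1; in dimension 1 this is the complete
   graph on two vertices. Dimension 0 is a placeholder. *)
Fixpoint augmented_cube (n : nat) : rel (n.-tuple bool) :=
  match n return rel (n.-tuple bool) with
  | 0 => fun _ _ => false
  | m.+1 => fun x y =>
      if m is 0 then x != y else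
      let x' : m.-tuple bool := [tuple of behead x] in
      let y' : m.-tuple bool := [tuple of behead y] in
      if thead x == thead y then augmented_cube x' y'
      else (y' == x') || (y' == [tuple of map negb x'])
  end.

Lemma augmented_cubeSS n (x y : n.+2.-tuple bool) :
  augmented_cube x y =
    if thead x == thead y then
      @augmented_cube n.+1 [tuple of behead x] [tuple of behead y]
    else ([tuple of behead y] == [tuple of behead x])
      || ([tuple of behead y] == [tuple of map negb (behead x)]).
Proof. by []. Qed.

Lemma augmented_cube_irr n : irreflexive (@augmented_cube n).
Proof.
elim: n => // -[|n] IHn x; first by rewrite /= eqxx.
by rewrite augmented_cubeSS eqxx; apply: IHn.
Qed.

Lemma augmented_cube_sym n : symmetric (@augmented_cube n).
Proof.
elim: n => // -[|n] IHn x y; first by rewrite /= eq_sym.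
rewrite !augmented_cubeSS [thead y == _]eq_sym; case: ifP => _; first exact: IHn.
rewrite eq_sym; congr (_ || _).
by apply/eqP/eqP => /(congr1 val) /= eq_xy; apply/val_inj;
  rewrite /= eq_xy -map_comp (eq_map negbK) map_id.
Qed.

(* Main.v *)
(** Let n = 2k + 1.

    Upper bound. For D = {0, 0..011, 0..0110} the three vertices have four common
    neighbours. A D-path uses at least four of the 3(2n - 1) pairs (d, v) with d in D
    and dv an edge, and at each common neighbour one of the three pairs is not used
    by any of the paths, so 4 pi(D) + 4 <= 3(2n - 1).

    Lower bound. AQ_n is a Cayley graph of the group of bit strings; in suitable
    coordinates the generators are the unit vectors u_i and the sums u_i + u_(i+1).
    For any D some coordinate j separates D as {x, y} | z. The hyperplane j = 0 is
    spanned by at least 2n - 4 = 4k - 2 generators and, by Hamidoune's argument on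
    atoms, the Cayley graph it carries has connectivity at least 4k - 2. Menger's
    theorem gives 4k - 2 paths between x and y on their side: 2k of them are kept,
    2k - 2 are cut open. The edges to the other side, taken at the cut ends and at x
    and y themselves, lead to 4k - 2 vertices, from which a fan leads to z. Altogether
    this gives 2k paths from x to y and 2k - 1 from each of them to z, which are
    joined in pairs to 3k - 1 D-paths. A path consisting of at most one inner vertex
    cannot be cut; x and y have at most six such paths, which is harmless for k >= 3,
    and for k = 2 a good coordinate is found by inspection, up to one
    exceptional D (and its translates) for which the paths are given explicitly. *)
Require Import Defs.
From HB Require Import structures.
From mathcomp Require Import all_boot ssralg countalg finalg zify.

Set Implicit Arguments.
Unset Strict Implicit.
Unset Printing Implicit Defensive.

Import GRing.Theory.

(** * Menger's theorem *)

Section Menger.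

Variable T : finType.
Implicit Types (e : rel T) (A B X : {set T}) (p s : seq T).

Definition path_between e A B p :=
  if p is a :: s then [&& a \in A, path e a s & last a s \in B] else false.

(** The relation tests only the targets of arcs, so the start is kept out of [X] separately. *)
Definition joined_avoiding e A B X :=
  [exists a in A :\: X, exists b in B,
     connect [rel u v | e u v && (v \notin X)] a b].

Lemma path_avoiding e X a s :
  path [rel u v | e u v && (v \notin X)] a s =
  path e a s && all [predC X] s.
Proof.
elim: s a => //= b s IHs a; rewrite IHs.
by rewrite -!andbA; congr (_ && _); rewrite andbCA.
Qed.

Lemma joined_avoidingP e A B X :
  reflect (exists2 p, path_between e A B p & all [predC X] p)
          (joined_avoiding e A B X).
Proof.
apply: (iffP existsP) => [[a /andP[/setDP[aA aX] /existsP[b /andP[bB]]]] | ].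
  case/connectP=> s; rewrite path_avoiding => /andP[es sX] b_s.
  by exists (a :: s); rewrite /= ?aA ?es -?b_s ?bB ?aX.
case=> -[|a s] //= /and3P[aA es lB] /andP[aX sX].
exists a; rewrite in_setD aA aX; apply/existsP; exists (last a s).
by rewrite lB; apply/connectP; exists s; rewrite ?path_avoiding ?es.
Qed.

(** The set version of Menger's theorem: arcs are directed, and a separator may contain vertices of
    [A] and [B]. *)
Definition inseparable e A B k :=
  [forall X : {set T}, (#|X| < k) ==> joined_avoiding e A B X].

Definition linkage e A B k (f : 'I_k -> seq T) :=
  [/\ forall i, path_between e A B (f i), forall i, uniq (f i) &
      forall i j v, v \in f i -> v \in f j -> i = j].

Lemma path_between_mono e e' A B p :
  subrel e e' -> path_between e A B p -> path_between e' A B p.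
Proof.
move=> sub; case: p => //= a s /and3P[-> es ->].
by rewrite (sub_path sub es).
Qed.

Lemma path_between_cat e A B p u s :
  path_between e A B (p ++ u :: s) =
  path_between e A [set u] (rcons p u) && path_between e [set u] B (u :: s).
Proof.
case: p => [|a p] /=; first by rewrite !inE eqxx /= andbT.
by rewrite cat_path rcons_path last_rcons !inE eqxx last_cat /= !andbT -!andbA.
Qed.

(** Without arcs the only paths are single vertices of [A :&: B], which is itself a separator and so
    has at least [k] elements. *)
Lemma menger_no_arcs e A B k :
  (forall u v, ~~ e u v) -> inseparable e A B k -> exists f : 'I_k -> seq T, linkage e A B f.
Proof.
move=> e0 /forallP sepk.
have leq_k: k <= #|A :&: B|.
  rewrite leqNgt; apply/negP => lt_k.
  have /joined_avoidingP[[|a [|b s]]] // := implyP (sepk _) lt_k.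
    by rewrite /= inE => /andP[-> ->].
  by rewrite /= (negPf (e0 _ _)) andbF.
exists (fun i => [:: enum_val (widen_ord leq_k i)]); split=> // [i | i j v].
  by have /setIP[] := enum_valP (widen_ord leq_k i) => /= -> ->.
rewrite !inE => /eqP -> /eqP /enum_val_inj /(congr1 val) /= eq_ij.
exact: val_inj.
Qed.

(** Disjoint paths end in different vertices of [B]; when [B] has at most [k] elements these ends
    exhaust it, so no path meets [B] before its end. *)
Lemma linkage_last e A B k (f : 'I_k -> seq T) : linkage e A B f -> #|B| <= k ->
  #|B| = k /\
  forall b, b \in B -> exists i, exists2 s, f i = rcons s b & all [predC B] s.
Proof.
case=> fP fU fD leBk.
have [B0 | [v0 _]] := set_0Vmem B.
  case: k f fP {fU fD leBk} => [|k] f fP; last first.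
    by have:= fP ord0; rewrite B0; case: (f ord0) => //= a s; rewrite inE !andbF.
  by rewrite B0 cards0; split=> // b; rewrite inE.
pose l i := last v0 (f i).
have lf i : l i \in f i.
  by rewrite /l; have:= fP i; case: (f i) => //= a s _; apply: mem_last.
have l_inj: injective l.
  by move=> i j eq_l; apply: fD (lf i) _; rewrite eq_l lf.
have lB i : l i \in B.
  by rewrite /l; have:= fP i; case: (f i) => //= a s /and3P[].
have defB: [set l i | i : 'I_k] = B.
  apply/eqP; rewrite eqEcard card_imset // card_ord leBk andbT.
  by apply/subsetP=> _ /imsetP[i _ ->].
split; first by rewrite -{1}defB card_imset // card_ord.
move=> b; rewrite -{1}defB => /imsetP[i _ ->]; exists i.
have:= lf i; have:= fU i; rewrite /l.
case/lastP def_f: (f i) => [|s c] //; rewrite last_rcons => Us _; exists s => //.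
apply/allP=> w sw; apply/negP; rewrite -defB => /imsetP[j _ def_w].
have eq_ij: i = j.
  by apply: (fD _ _ w); rewrite ?def_w ?lf // -def_w def_f mem_rcons inE sw orbT.
have eq_wc: w = c by rewrite def_w -eq_ij /l def_f last_rcons.
by move: Us; rewrite rcons_uniq -eq_wc sw.
Qed.

Lemma linkage_head e A B k (f : 'I_k -> seq T) : linkage e A B f -> #|A| <= k ->
  #|A| = k /\
  forall a, a \in A -> exists i, exists2 s, f i = a :: s & all [predC A] s.
Proof.
case=> fP fU fD leAk.
pose e' := [rel u v | e v u].
have fP' i : path_between e' B A (rev (f i)).
  have:= fP i; case: (f i) => //= a s /and3P[aA es lB].
  rewrite lastI rev_rcons /= lB rev_path es.
  by case: (s) => //= b s'; rewrite rev_cons last_rcons.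
have [||cA fA] := @linkage_last e' B A k (rev \o f) => //.
  by split=> // [i | i j v /=]; rewrite /= ?rev_uniq // !mem_rev; apply: fD.
split=> // a /fA[i [s /= def_f sA]]; exists i; exists (rev s).
  by rewrite -[f i]revK def_f rev_rcons.
by rewrite all_rev.
Qed.

(** The arc is traversed only if [x] occurs before the end of the path and [y] after its start. *)
Lemma path_remove_arc e x y a s :
    (forall p, a :: s = rcons p (last a s) -> x \notin p) \/ y \notin s ->
  path e a s -> path [rel u v | e u v && ((u, v) != (x, y))] a s.
Proof.
case=> [xs | ys].
  elim: s a xs => //= b s IHs a xs /andP[-> es] /=; apply/andP; split.
    apply/eqP=> -[ax _]; have := xs (a :: belast b s).
    by rewrite -ax lastI /= -lastI inE eqxx => /(_ erefl).
  apply: IHs es => p def_s; have:= xs (a :: p).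
  by rewrite def_s inE negb_or => /(_ erefl)/andP[].
elim: s a ys => //= b s IHs a; rewrite inE negb_or => /andP[y'b ys] /andP[-> es].
by rewrite /= IHs // xpair_eqE (eq_sym b) (negPf y'b) andbF.
Qed.

Lemma split_first (P : pred T) s :
  has P s -> exists p, exists w, exists2 q, s = p ++ w :: q & P w && all [predC P] p.
Proof.
elim: s => //= a s IHs; have [Pa _ | Pa /= hs] := boolP (P a).
  by exists [::], a, s; rewrite ?Pa.
have [p [w [q -> /andP[Pw Pp]]]] := IHs hs.
by exists (a :: p), w, q; rewrite //= Pw Pp Pa.
Qed.

Lemma split_last (P : pred T) s :
  has P s -> exists p, exists w, exists2 q, s = p ++ w :: q & P w && all [predC P] q.
Proof.
rewrite -has_rev => /split_first[p [w [q def_s Pwp]]].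
exists (rev q), w, (rev p); last by rewrite all_rev.
by rewrite -[s]revK def_s rev_cat rev_cons cat_rcons.
Qed.

Lemma path_between_rcons e A B p u :
  path_between e A B (rcons p u) =
  path_between e A [set u] (rcons p u) && (u \in B).
Proof. by rewrite -[X in path_between _ _ B X]cats1 path_between_cat /= inE eqxx. Qed.

(* Goering's induction on the number of arcs: if deleting the arc (x, y) leaves a
   separator X that is too small, then X + x and X + y are separators of the whole
   graph, and no path from A to X + x, nor from X + y to B, needs the arc. *)
Theorem menger e A B k :
  inseparable e A B k -> exists f : 'I_k -> seq T, linkage e A B f.
Proof.
have [m] := ubnP #|[set a : T * T | e a.1 a.2]|.
elim: m => // m IHm in e A B *; rewrite ltnS => lem sepk.
have [e0 | ] := set_0Vmem [set a : T * T | e a.1 a.2].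
  by apply: menger_no_arcs sepk => u v; have/setP/(_ (u, v)) := e0; rewrite !inE /= => /negbT.
case=> -[x y]; rewrite inE /= => exy.
pose e' := [rel u v | e u v && ((u, v) != (x, y))].
have sub_e' : subrel e' e by move=> u v /andP[].
have {lem} IHe C D : inseparable e' C D k -> exists f : 'I_k -> seq T, linkage e' C D f.
  apply: IHm; apply: leq_trans lem; apply/proper_card/properP; split.
    by apply/subsetP=> u; rewrite !inE => /andP[].
  by exists (x, y); rewrite !inE /= exy ?eqxx.
have [/IHe[f [fP fU fD]] | ] := boolP (inseparable e' A B k).
  by exists f; split=> // i; apply: path_between_mono (fP i).
case/forallPn=> X; rewrite negb_imply => /andP[ltXk noAB].
have hitX p : path_between e' A B p -> has [in X] p.
  move=> pP; apply: contraR noAB; rewrite -all_predC => pX.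
  by apply/joined_avoidingP; exists p.
have hitP p : path_between e A B p -> has [in x |: X] p.
  move=> pP; have [xp | x'p] := boolP (x \in p).
    by apply/hasP; exists x; rewrite ?setU11.
  suff /hitX/hasP[w wp wX]: path_between e' A B p.
    by apply/hasP; exists w; rewrite // inE wX orbT.
  case: p pP x'p => //= a s /and3P[-> es ->]; rewrite inE negb_or => /andP[x'a x's].
  rewrite path_remove_arc //; left=> p def_s.
  have: x \notin a :: s by rewrite inE negb_or x'a.
  by rewrite def_s mem_rcons inE negb_or => /andP[].
have hitQ p : path_between e A B p -> has [in y |: X] p.
  move=> pP; have [yp | y'p] := boolP (y \in p).
    by apply/hasP; exists y; rewrite ?setU11.
  suff /hitX/hasP[w wp wX]: path_between e' A B p.
    by apply/hasP; exists w; rewrite // inE wX orbT.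
  case: p pP y'p => //= a s /and3P[-> es ->]; rewrite inE negb_or => /andP[y'a y's].
  by rewrite path_remove_arc //; right.
have [fA linkA] : exists f : 'I_k -> seq T, linkage e' A (x |: X) f.
  apply: IHe; apply/forallP=> Y; apply/implyP=> ltYk.
  have /joined_avoidingP[p pP pY] := implyP (forallP sepk Y) ltYk.
  (* Before its first vertex in [x |: X] the path does not meet [x], so this portion survives the
     deletion of the arc. *)
  have /split_first[p1 [w [p2 def_p /andP[Pw Pp1]]]] := hitP p pP.
  apply/joined_avoidingP; exists (rcons p1 w); last first.
    by move: pY; rewrite def_p -cat_rcons all_cat => /andP[].
  move: pP; rewrite def_p path_between_cat => /andP[p1P _].
  case: p1 {def_p} Pp1 p1P => [_ /= /andP[-> _] // | a s].
  rewrite /= last_rcons => /andP[Pa Ps] /and3P[-> es _]; rewrite [_ \in x |: X]Pw andbT.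
  apply: path_remove_arc es; left=> q; rewrite last_rcons -rcons_cons.
  case/rcons_inj=> <-; apply/negP; rewrite inE; case/predU1P=> [def_x | xs].
    by move: Pa; rewrite -def_x /= setU11.
  by have /= := allP Ps _ xs; rewrite setU11.
have [fB linkB] : exists f : 'I_k -> seq T, linkage e' (y |: X) B f.
  apply: IHe; apply/forallP=> Y; apply/implyP=> ltYk.
  have /joined_avoidingP[p pP pY] := implyP (forallP sepk Y) ltYk.
  have /split_last[p1 [w [p2 def_p /andP[Pw Pp2]]]] := hitQ p pP.
  apply/joined_avoidingP; exists (w :: p2); last first.
    by move: pY; rewrite def_p all_cat => /andP[].
  move: pP; rewrite def_p path_between_cat => /andP[_ /and3P[_ es lB]].
  rewrite /= lB [_ \in y |: X]Pw andbT; apply: path_remove_arc es; right.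
  by apply/negP=> /(allP Pp2); rewrite /= setU11.
have leU1 v : #|v |: X| <= k.
  by rewrite cardsU1; apply: leq_trans ltXk; rewrite -add1n leq_add2r leq_b1.
have [cP lastA] := linkage_last linkA (leU1 x).
have [cQ headB] := linkage_head linkB (leU1 y).
have x'X : x \notin X.
  by apply: contraTN ltXk => xX; rewrite -leqNgt -cP (setUidPr _) ?sub1set.
have y'X : y \notin X.
  by apply: contraTN ltXk => yX; rewrite -leqNgt -cQ (setUidPr _) ?sub1set.
case: linkA => [PA UA DA]; case: linkB => [PB UB DB].
(* Splicing the two paths at [v] gives a path from [A] to [B] in [e'], which must meet [X]. As
   [fA i] meets [X] only in its last vertex and [fB j] only in its first, the meeting point is
   [v]. *)
have meetX i j v : v \in fA i -> v \in fB j ->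
  [/\ v \in X, exists s, fA i = rcons s v & exists s, fB j = v :: s].
  have lastX u : u \in fA i -> u \in X -> exists s, fA i = rcons s u.
    move=> fu Xu; have [|i' [s def_f _]] := lastA u; first by rewrite inE Xu orbT.
    rewrite (DA i i' u) //; first by exists s.
    by rewrite def_f mem_rcons inE eqxx.
  have headX u : u \in fB j -> u \in X -> exists s, fB j = u :: s.
    move=> fu Xu; have [|j' [s def_f _]] := headB u; first by rewrite inE Xu orbT.
    rewrite (DB j j' u) //; first by exists s.
    by rewrite def_f inE eqxx.
  move=> Av Bv; suff Xv: v \in X by split; [|exact: lastX|exact: headX].
  have [p1 [p2 def_A]] : exists p1, exists p2, fA i = p1 ++ v :: p2.
    by case/splitPr: (fA i) / Av => p1 p2; exists p1, p2.
  have [q1 [q2 def_B]] : exists q1, exists q2, fB j = q1 ++ v :: q2.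
    by case/splitPr: (fB j) / Bv => q1 q2; exists q1, q2.
  have /hitX/hasP[u] : path_between e' A B (p1 ++ v :: q2).
    move: (PA i) (PB j); rewrite def_A def_B !path_between_cat.
    by case/andP=> -> _ /andP[_ ->].
  rewrite mem_cat inE => /or3P[p1u | /eqP-> // | q2u] /= Xu.
    have [|s def_s] := lastX u _ Xu; first by rewrite def_A mem_cat p1u.
    have lu : u = last v p2.
      by rewrite -(last_rcons v s u) -def_s def_A last_cat.
    have:= UA i; rewrite def_A cat_uniq => /and3P[_ /hasPn/(_ u)].
    by rewrite {1}lu mem_last /= p1u => /(_ isT).
  have [|s def_s] := headX u _ Xu; first by rewrite def_B mem_cat inE q2u !orbT.
  have hu : u = head v q1.
    by have:= congr1 (head v) def_s; rewrite def_B; case: (q1).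
  have:= UB j; rewrite def_B -cat_rcons cat_uniq => /and3P[_ /hasPn/(_ u)].
  rewrite q2u mem_rcons inE hu => /(_ isT).
  by case: (q1) => [|a q] /=; rewrite ?inE ?eqxx ?orbT.
pose w i := last x (fA i).
(* A path ending in [x] is continued from [y] across the deleted arc, every other path from its own
   end. *)
pose sg u := if u == x then y else u.
have wA i : w i \in fA i.
  by rewrite /w; have:= PA i; case: (fA i) => //= a s _; apply: mem_last.
have wP i : w i \in x |: X.
  by rewrite /w; have:= PA i; case: (fA i) => //= a s /and3P[].
have sg_inj : {in x |: X &, injective sg}.
  move=> u v; rewrite /sg !inE.
  case: eqP => [-> _ | _ /= Xu]; case: eqP => [-> | _ /= Xv] //.
    by move=> eq_yv; rewrite eq_yv Xv in y'X.
  by move=> _ eq_uy; rewrite -eq_uy Xu in y'X.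
(* The default [i] is never returned, since [headB] provides a path of [fB] for every vertex of
   [y |: X]. *)
pose h i := odflt i [pick j | head x (fB j) == sg (w i)].
have hB i : exists s, fB (h i) = sg (w i) :: s.
  have [j [s def_f _]] : exists j, exists2 s, fB j = sg (w i) :: s & all [predC y |: X] s.
    apply: headB; rewrite /sg; have:= wP i; rewrite !inE.
    by case: eqP => [_ _ | _ /= ->]; rewrite ?eqxx ?orbT.
  rewrite /h; case: pickP => [j' /eqP | /(_ j)]; last by rewrite def_f /= eqxx.
  by have:= PB j'; case: (fB j') => //= a s' _ ->; exists s'.
have h_inj : injective h.
  move=> i i' eq_h; have [s def_s] := hB i; have [s' def_s'] := hB i'.
  move: def_s; rewrite eq_h def_s' => -[/sg_inj eq_w _].
  by apply: (DA _ _ (w i)); rewrite ?wA // -eq_w ?wA ?wP.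
(* The junction vertex is dropped when it already ends [fA i]. *)
pose r i := if w i == x then fB (h i) else behead (fB (h i)).
have rB i v : v \in r i -> v \in fB (h i).
  by rewrite /r; case: ifP => // _ /mem_behead.
have fAr i i' v : v \in fA i -> v \notin r i'.
  move=> Av; apply/negP=> rv; have [Xv _ [s def_s]] := meetX _ _ _ Av (rB _ _ rv).
  have [s' def_s'] := hB i'; move: rv def_s'; rewrite /r /sg def_s.
  case: ifP => [_ _ [def_v _] | _ /= sv _]; first by rewrite -def_v Xv in y'X.
  by have:= UB (h i'); rewrite def_s /= sv.
exists (fun i => fA i ++ r i); split=> [i | i | i i' v].
- have [s def_A] : exists s, fA i = rcons s (w i).
    rewrite /w; have:= PA i; case/lastP: (fA i) => // s a _.
    by exists s; rewrite last_rcons.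
  have:= path_between_mono sub_e' (PA i).
  rewrite def_A path_between_rcons cat_rcons path_between_cat => /andP[-> _] /=.
  have [t def_B] := hB i.
  have:= path_between_mono sub_e' (PB (h i)).
  rewrite /r def_B /sg; case: eqP => [-> | _] /and3P[_ /= -> lt]; rewrite inE eqxx //=.
  by rewrite exy.
- rewrite cat_uniq UA /=; apply/andP; split.
    by apply/hasPn=> v; apply: contraL; apply: fAr.
  rewrite /r; case: ifP => _; rewrite ?UB //.
  by have [t def_B] := hB i; have:= UB (h i); rewrite def_B => /andP[].
rewrite !mem_cat => /orP[Av | rv] /orP[A'v | r'v].
- exact: DA Av A'v.
- by have:= fAr i i' v Av; rewrite r'v.
- by have:= fAr i' i v A'v; rewrite rv.
by apply: h_inj; apply: (DB _ _ v); apply: rB.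
Qed.
End Menger.

(** * Local paths and fans *)

Lemma uniq_flatten_map (I T : eqType) (F : I -> seq T) (r : seq I) :
    uniq r -> {in r, forall i, uniq (F i)} ->
    {in r &, forall i j v, v \in F i -> v \in F j -> i = j} ->
  uniq (flatten [seq F i | i <- r]).
Proof.
elim: r => //= i r IHr /andP[r'i Ur] UF DF; rewrite cat_uniq UF ?mem_head //=.
rewrite IHr // => [|j rj|j k rj rk]; rewrite ?andbT; first 1 last.
- by apply: UF; rewrite inE rj orbT.
- by apply: DF; rewrite inE ?rj ?rk orbT.
apply/hasPn=> v /flatten_mapP[j rj Fj]; apply: contra r'i => Fi.
by rewrite (DF i j _ _ v) ?inE ?eqxx ?rj ?orbT.
Qed.

Section Expansion.

Variables (V : finType) (e : rel V).
Hypotheses (e_sym : symmetric e) (e_irr : irreflexive e).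
Implicit Types (U F X : {set V}) (x y z : V) (c : nat).

Definition nbrs U F := [set v in U :\: F | [exists w in F, e w v]].

(** A form of [c]-connectivity of the graph induced on [U]. The degree condition takes care of
    complete graphs, where every nonempty set has closed neighbourhood [U]. *)
Definition expanding U c :=
  (forall x, x \in U -> c <= #|[set v in U | e x v]|) /\
  (forall F, F \subset U -> F != set0 -> ~~ (U \subset F :|: nbrs U F) ->
     c <= #|nbrs U F|).

Definition within U := [rel u v | e u v && (v \in U)].

(** [R] collects what is reachable from [A] inside [U] off [X]. A separator in Menger's theorem thus
    becomes a boundary, to which [expanding] applies. *)
Lemma separated_side U (A B : {set V}) X : A \subset U -> ~~ joined_avoiding (within U) A B X ->
  exists R : {set V}, [/\ R \subset U, A :\: X \subset R, [disjoint R & B] &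
    forall w v, w \in R -> e w v -> v \in U :\: X -> v \in R].
Proof.
move=> sAU nAB; pose r := [rel u v | within U u v && (v \notin X)].
exists [set v | [exists a in A :\: X, connect r a v]]; split.
- apply/subsetP=> v; rewrite inE => /existsP[a /andP[/setDP[/(subsetP sAU) Ua _]]].
  case/connectP=> s; elim/last_ind: s v => [|s b _] v /=; first by move=> _ ->.
  by rewrite last_rcons rcons_path => /andP[_ /andP[/andP[_ Ub] _]] ->.
- by apply/subsetP=> a Aa; rewrite inE; apply/existsP; exists a; rewrite Aa connect0.
- apply/pred0P=> b /=; rewrite inE; apply: contraNF nAB.
  case/andP=> /existsP[a /andP[Aa ab] Bb]; apply/existsP; exists a; rewrite Aa.
  by apply/existsP; exists b; rewrite Bb.
move=> w v; rewrite !inE => /existsP[a /andP[Aa aw]] ewv /andP[X'v Uv].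
apply/existsP; exists a; rewrite Aa; apply: connect_trans aw (connect1 _).
by rewrite /= ewv Uv.
Qed.

Lemma all_path_within U a s : path (within U) a s = path e a s && all [in U] s.
Proof.
elim: s a => //= b s IHs a; rewrite IHs.
by rewrite -!andbA; congr (_ && _); rewrite andbCA.
Qed.

(** Menger's theorem is applied in [U] without [x] and [y], between their neighbourhoods: if a small
    [X] separated these, [x] together with its side [R] would have too few neighbours. Each [s]
    lists inner vertices only; the edge from [x] to [y], if present, accounts for the missing
    path. *)
Lemma local_paths U c x y : expanding U c -> x \in U -> y \in U -> x != y ->
  exists L : seq (seq V), [/\ size L = c - e x y, uniq (flatten L) &
    forall s, s \in L ->
      [/\ s != [::], path e x (rcons s y) & all [in U :\: [set x; y]] s]].
Proof.
case=> degU expU Ux Uy xy; pose W := U :\: [set x; y].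
pose A := [set v in W | e x v]; pose B := [set v in W | e v y].
have sAW : A \subset W by apply/subsetP=> v; rewrite inE => /andP[].
have [|f [fP fU fD]] := @menger _ (within W) A B (c - e x y).
  apply/forallP=> X; apply/implyP=> ltX; apply: contraT.
  case/separated_side=> // R [sRW sAR dRB clR].
  have notB w : w \in R -> e w y = false.
    move=> Rw; apply: contraFF (disjointFr dRB Rw) => ewy.
    by rewrite inE (subsetP sRW).
  pose F := x |: R.
  have sFU : F \subset U.
    by rewrite subUset sub1set Ux (subset_trans sRW (subsetDl _ _)).
  (* No vertex of [R] is adjacent to [y], so [y] is a neighbour of [F] only through [x]. *)
  have nF v : v \in nbrs U F -> if v == y then e x y else v \in X.
    rewrite inE in_setD => /andP[/andP[F'v Uv] /existsP[w /andP[Fw ewv]]].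
    case: eqP => [vy | /eqP y'v].
      by case/setU1P: Fw ewv => [-> | /notB]; rewrite vy // => ->.
    apply: contraR F'v => X'v; rewrite in_setU1; case: eqVneq => //= x'v.
    have Wv : v \in W by rewrite !inE Uv negb_or x'v y'v.
    case/setU1P: Fw => [wx | Rw].
      by apply: (subsetP sAR); rewrite in_setD X'v inE Wv -wx ewv.
    by apply: clR Rw ewv _; rewrite inE X'v.
  have le_nF : #|nbrs U F| <= #|X| + e x y.
    case: (boolP (e x y)) => [exy | /negPf exy].
      rewrite addn1 -(leq_add2l (y \notin X)) -ltnS.
      have /subset_leq_card : nbrs U F \subset y |: X.
        by apply/subsetP=> v /nF; rewrite !inE; case: eqP.
      by rewrite cardsU1; lia.
    rewrite addn0; apply/subset_leq_card/subsetP=> v /nF.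
    by case: eqP => //; rewrite exy.
  suff: c <= #|nbrs U F| by lia.
  apply: expU => //; first by apply/set0Pn; exists x; rewrite setU11.
  (* The vertex missed by [F] and its neighbours is [y] if it is not adjacent to [x]; otherwise it
     is a neighbour of [y] outside [X], which exists by the degree condition. *)
  case: (boolP (e x y)) => [exy | /negPf exy]; last first.
    apply/subsetPn; exists y; rewrite // in_setU negb_or; apply/andP; split; last first.
      by apply/negP=> /nF; rewrite eqxx exy.
    rewrite in_setU1 eq_sym (negPf xy) /=; apply/negP=> /(subsetP sRW).
    by rewrite !inE eqxx orbT.
  have [b Bb X'b] : exists2 b, b \in B & b \notin X.
    apply/subsetPn/negP=> /subset_leq_card.
    have : #|[set v in U | e y v]| <= #|x |: B|.
      apply/subset_leq_card/subsetP=> v; rewrite !inE e_sym => /andP[-> evy].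
      rewrite evy !andbT; case: eqP => //= _; apply: contraL evy => /eqP->.
      by rewrite e_irr.
    by have:= degU y Uy; rewrite cardsU1; lia.
  have R'b : b \notin R by rewrite (disjointFl dRB).
  move: (Bb); rewrite !inE negb_or -!andbA => /and4P[x'b y'b Ub eby].
  apply/subsetPn; exists b; rewrite // in_setU in_setU1 (negPf x'b) (negPf R'b) /=.
  by apply/negP=> /nF; rewrite (negPf y'b) (negPf X'b).
exists [seq f i | i <- enum 'I_(c - e x y)]; split.
- by rewrite size_map size_enum_ord.
- by apply: uniq_flatten_map => [|i _|i j _ _ v]; rewrite ?enum_uniq //; apply: fD.
move=> _ /mapP[i _ ->]; have:= fP i; case: (f i) => // a s.
rewrite /= all_path_within rcons_path !inE => /and3P[/andP[-> ->] /andP[-> ->]].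
by case/andP=> _ ->.
Qed.

(** Menger's theorem is applied in [U] without [z], between [Z] and the neighbours of [z]. [F t]
    runs from [t] to such a neighbour; for [t = z] it is empty, so that appending [z] is correct in
    both cases. *)
Lemma fan U c z (Z : seq V) : expanding U c -> z \in U -> uniq Z -> all [in U] Z ->
    size Z <= c ->
  exists F : V -> seq V, [/\ uniq (flatten (map F Z)),
    {in Z, forall t, F t = [::] -> t = z} &
    {in Z, forall t, all [in U :\ z] (F t) /\
       forall x, e x t -> path e x (rcons (F t) z)}].
Proof.
case=> degU expU Uz UZ ZU leZ; pose W := U :\ z.
pose A := [set t in Z | t != z]; pose B := [set v in W | e v z].
have sAW : A \subset W.
  by apply/subsetP=> t; rewrite !inE => /andP[/(allP ZU) -> ->].
have leA : #|A| <= c.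
  rewrite (leq_trans _ leZ) // -(card_uniqP UZ); apply/subset_leq_card/subsetP=> t.
  by rewrite inE => /andP[].
(* Asking for [#|A|] paths makes every vertex of [A] the start of exactly one. *)
have [|f fL] := @menger _ (within W) A B #|A|.
  apply/forallP=> X; apply/implyP=> ltX; apply: contraT.
  case/separated_side=> // R [sRW sAR dRB clR].
  have nR v : v \in nbrs U R -> v \in X :\ z.
    rewrite inE in_setD => /andP[/andP[R'v Uv] /existsP[w /andP[Rw ewv]]].
    have [vz | z'v] := eqVneq v z.
      by have:= disjointFr dRB Rw; rewrite inE (subsetP sRW) // -vz ewv.
    by rewrite !inE z'v; apply: contraR R'v => X'v; apply: clR Rw ewv _; rewrite !inE X'v z'v.
  have : #|nbrs U R| <= #|X|.
    by apply/subset_leq_card/subsetP=> v /nR /setD1P[].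
  suff: c <= #|nbrs U R| by lia.
  apply: expU; first exact: subset_trans sRW (subsetDl _ _).
    have /subsetPn[t At X't] : ~~ (A \subset X).
      by apply/negP=> /subset_leq_card; lia.
    by apply/set0Pn; exists t; apply: (subsetP sAR); rewrite inE X't.
  apply/subsetPn; exists z; rewrite // inE negb_or; apply/andP; split.
    by apply/negP=> /(subsetP sRW); rewrite !inE eqxx.
  by apply/negP=> /nR; rewrite !inE eqxx.
have [_ headA] := linkage_head fL (leqnn _); case: fL => fP fU fD.
pose F t := if [pick i | ohead (f i) == Some t] is Some i then f i else [::].
have FA t : t \in A -> exists i s, F t = f i /\ f i = t :: s.
  case/headA=> j [s def_f _]; rewrite /F.
  case: pickP => [i | /(_ j)]; last by rewrite def_f /= eqxx.
  by case def_i: (f i) => [|a s'] // /eqP[<-]; exists i, s'.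
have FN t : t \in Z -> t \notin A -> t = z /\ F t = [::].
  move=> Zt A't; have tz: t = z by move: A't; rewrite inE Zt /= negbK => /eqP.
  split=> //; rewrite /F; case: pickP => // i; have := fP i.
  case: (f i) => // a s /= /and3P[/(subsetP sAW)]; rewrite !inE => /andP[z'a _] _ _ /eqP[az].
  by rewrite az tz eqxx in z'a.
clearbody F; exists F; split.
- apply: uniq_flatten_map => // t.
    move=> Zt; have [/FA[i [s [-> _]]] // | A't] := boolP (t \in A).
    by have [_ ->] := FN t Zt A't.
  move=> t' Zt Zt' v.
  have [/FA[i [s [-> def_i]]] | /(FN t Zt)[_ ->] //] := boolP (t \in A) => fi.
  have [/FA[j [s' [-> def_j]]] | /(FN t' Zt')[_ ->] //] := boolP (t' \in A) => fj.
  by have:= fD _ _ _ fi fj => eq_ij; move: def_i; rewrite eq_ij def_j => -[].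
- move=> t Zt F0; apply/eqP; apply: contraT => z't.
  have [|i [s [def_F def_i]]] := FA t; first by rewrite inE Zt.
  by rewrite def_F def_i in F0.
move=> t Zt; have [/FA[i [s [-> def_i]]] | /(FN t Zt)[-> ->]] := boolP (t \in A); last first.
  by split=> // x /= ->.
have:= fP i; rewrite def_i /= all_path_within => /and3P[At /andP[es sW] /[!inE] /andP[_ lz]].
split=> [|x ext]; first by have:= subsetP sAW t At; rewrite sW andbT !inE.
by rewrite rcons_path ext es lz.
Qed.

End Expansion.

(** * Connectivity of Cayley graphs of elementary abelian 2-groups *)

(** Here [a] is meant as the order of a subgroup and [r] as a number of cosets that generate the
    whole group with it. If [N = r + t + 1], then [a >= 2 ^ (t + 1) >= 2 * (t + 1)], and
    [r * (t + 1) >= r + t]. *)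
Lemma coset_bound (N a r : nat) : (2 ^ N <= a * 2 ^ r -> 1 < a -> 0 < r ->
  2 * N.-1 <= r * a)%N.
Proof.
move=> le2N a_gt1 r_gt0; have [leNr | ltrN] := leqP N r; first by nia.
have [t defN] : exists t, N = (r + t.+1)%N by exists (N - r).-1; lia.
have: (2 ^ t.+1 <= a)%N.
  by move: le2N; rewrite defN expnD mulnC leq_mul2r expn_eq0.
have : (t < 2 ^ t)%N by apply: ltn_expl.
by rewrite expnS defN; nia.
Qed.

Section Isoperimetry.

Local Open Scope ring_scope.

Variables (V : finZmodType) (addvv : forall v : V, v + v = 0) (S : {set V}).
Implicit Types (u v a s : V) (F G : {set V}).

Lemma addrKv u v : u + v + v = u.
Proof. by rewrite -addrA addvv addr0. Qed.

(** As every element is its own opposite, this is [F] shifted by [a]. *)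
Definition translate a F := [set v | v + a \in F].

Definition boundary F := [set v in ~: F | [exists s in S, v + s \in F]].

Lemma boundaryP F v :
  reflect (v \notin F /\ exists2 s, s \in S & v + s \in F) (v \in boundary F).
Proof.
rewrite !inE; apply: (iffP andP) => -[v'F].
  by case/existsP=> s /andP[sS Fs]; split=> //; exists s.
by case=> s sS Fs; split=> //; apply/existsP; exists s; rewrite sS.
Qed.

Lemma in_closed_nbhd F v s : s \in S -> v + s \in F -> v \in F :|: boundary F.
Proof.
move=> sS Fvs; rewrite inE; case: (boolP (v \in F)) => //= v'F.
by apply/boundaryP; split=> //; exists s.
Qed.

Lemma card_translate a F : #|translate a F| = #|F|.
Proof.
rewrite -(card_imset (translate a F) (@addIr V a)); apply: eq_card => v.
apply/imsetP/idP => [[u] | Fv]; first by rewrite inE => ? ->.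
by exists (v + a); rewrite ?inE addrKv.
Qed.

Lemma boundary_translate a F : boundary (translate a F) = translate a (boundary F).
Proof.
apply/setP=> v; rewrite !inE; congr (_ && _).
by apply: eq_existsb => s; rewrite inE addrAC.
Qed.

(** A point in one of the boundaries on the left lies in one of those on the right, and a point in
    both lies in both. *)
Lemma boundary_submodular F G :
  (#|boundary (F :&: G)| + #|boundary (F :|: G)| <=
   #|boundary F| + #|boundary G|)%N.
Proof.
rewrite -(cardsUI (boundary (F :&: G))) -(cardsUI (boundary F)); apply: leq_add; apply/subset_leq_card/subsetP=> v.
  case/setUP=> /boundaryP[]; rewrite !inE.
    rewrite negb_and => nFG [s sS]; rewrite !inE => /andP[Fs Gs].
    case/orP: nFG => ->; apply/orP; [left | right]; apply/existsP; exists s; rewrite sS //.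
  rewrite negb_or => /andP[-> ->] [s sS]; rewrite inE /=.
  by case/orP=> Fs; apply/orP; [left | right]; apply/existsP; exists s; rewrite sS.
case/setIP=> /boundaryP[_ [s sS]] /[!inE] /andP[Fs Gs] /andP[/norP[-> ->] _] /=.
by apply/andP; split; apply/existsP; exists s; rewrite sS.
Qed.

(** A set invariant under the subgroup [F] is a union of cosets, of which [r] lists
    representatives. *)
Lemma translate_cover F R : (forall a, a \in F -> translate a F = F) -> 0 \in F ->
    (forall a, a \in F -> translate a R = R) ->
  exists2 r : seq V, #|R| = (size r * #|F|)%N &
    forall v, v \in R -> exists2 x, x \in r & v + x \in F.
Proof.
move=> trF F0; have [m] := ubnP #|R|; elim: m => // m IHm in R *.
rewrite ltnS => leRm trR.
have [-> | [x Rx]] := set_0Vmem R.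
  by exists [::]; [rewrite cards0 | move=> v; rewrite inE].
have sub_R : translate x F \subset R.
  by apply/subsetP=> v; rewrite inE => /trR <-; rewrite inE addrA addvv add0r.
have xF : x \in translate x F by rewrite inE addvv.
have cR : #|R| = (#|F| + #|R :\: translate x F|)%N.
  by rewrite -(cardsID (translate x F) R) (setIidPr sub_R) card_translate.
have F_gt0 : (0 < #|F|)%N by apply/card_gt0P; exists 0.
have [||r cr rP] := IHm (R :\: translate x F); first by lia.
  move=> a Fa; apply/setP=> v; have /setP/(_ v) := trR a Fa.
  have /setP/(_ (v + x)) := trF a Fa; rewrite !inE => <- ->.
  by rewrite addrAC.
exists (x :: r); first by rewrite cR cr /= mulSn.
move=> v Rv; have [Fv | F'v] := boolP (v + x \in F).
  by exists x; rewrite ?inE ?eqxx.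
have [|y ry Fy] := rP v; first by rewrite !inE F'v.
by exists y; rewrite // inE ry orbT.
Qed.

(** When [F] is a subgroup, this is the subgroup generated by [F] and [r]; each element of [r] at
    most doubles it. *)
Fixpoint extend F (r : seq V) :=
  if r is x :: r' then extend F r' :|: translate x (extend F r') else F.

Lemma card_extend F r : (#|extend F r| <= #|F| * 2 ^ size r)%N.
Proof.
elim: r => [|x r IHr] /=; first by rewrite muln1.
rewrite expnS mulnCA mul2n -addnn; apply: leq_trans (leq_add IHr IHr).
by rewrite -{2}(card_translate x (extend F r)) leq_card_setU.
Qed.

Lemma extend_closed F r x v :
    (forall u a, u \in F -> a \in F -> u + a \in F) ->
  (x \in r) || (x \in F) -> v \in extend F r -> v + x \in extend F r.
Proof.
move=> FD; elim: r v => [|y r IHr] v /=; first by move=> Fx Fv; apply: FD.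
rewrite !inE -orbA => /predU1P[-> | /IHr rx].
  by rewrite addrKv orbC.
by case/orP=> /rx => [-> // | ]; rewrite addrAC => ->; rewrite orbT.
Qed.

Variables (H : {set V}) (N c : nat).
Hypotheses (HD : forall u v, u \in H -> v \in H -> u + v \in H).
Hypotheses (SH : S \subset H) (S0 : 0 \notin S).
Hypothesis genH : forall F, 0 \in F -> 
  (forall v s, v \in F -> s \in S -> v + s \in F) -> H \subset F.
Hypotheses (cardH : (2 ^ N <= #|H|)%N) (c_leS : (c <= #|S|)%N) (c_leN : (c <= 2 * N.-1)%N).

(** The sets whose boundary is a cut: nonempty, with a part of [H] left beyond the boundary. *)
Let frag F := [&& F \subset H, F != set0 & ~~ (H \subset F :|: boundary F)].

Let HDr u v : v \in H -> (u + v \in H) = (u \in H).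
Proof. by move=> Hv; apply/idP/idP=> Hu; [rewrite -(addrKv u v)|]; apply: HD. Qed.

Let boundaryH F : F \subset H -> boundary F \subset H.
Proof.
move=> sFH; apply/subsetP=> v /boundaryP[_ [s /(subsetP SH)Hs /(subsetP sFH)]].
by rewrite HDr.
Qed.

Let frag_translate a F : a \in H -> frag F -> frag (translate a F).
Proof.
move=> Ha /and3P[sFH /set0Pn[u Fu] /subsetPn[w Hw nw]]; apply/and3P; split.
- by apply/subsetP=> v; rewrite inE => /(subsetP sFH); rewrite HDr.
- by apply/set0Pn; exists (u + a); rewrite inE addrKv.
apply/subsetPn; exists (w + a); first by rewrite HDr.
by move: nw; rewrite boundary_translate !in_setU ![_ \in translate _ _]inE addrKv.
Qed.

(** The Cayley graph is undirected, so the part of [H] beyond the boundary of [F] has its own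
    boundary inside that of [F]. Hence an atom is no larger than what lies beyond its boundary. *)
Let frag_compl F : frag F -> 
  frag (H :\: (F :|: boundary F)) /\ boundary (H :\: (F :|: boundary F)) \subset boundary F.
Proof.
move=> /and3P[sFH /set0Pn[u Fu] nH].
set G := H :\: _; have sub: boundary G \subset boundary F.
  apply/subsetP=> v /boundaryP[G'v [s sS]]; rewrite inE => /andP[nvs].
  rewrite (HDr _ (subsetP SH s sS)) => Hv; move: G'v; rewrite in_setD Hv andbT negbK.
  case/setUP=> // Fv; case/negP: nvs; apply: in_closed_nbhd (sS) _.
  by rewrite addrKv.
split=> //; apply/and3P; split; first exact: subsetDl.
  by rewrite setD_eq0.
apply/subsetPn; exists u; first exact: (subsetP sFH).
rewrite in_setU negb_or !inE Fu /=; apply/negP.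
by move=> uG; have /(subsetP sub)/boundaryP[] : u \in boundary G; rewrite ?Fu // !inE Fu.
Qed.

(* Following Hamidoune, a smallest set of minimum boundary (an atom) is disjoint
   from its other translates, so the one through 0 is a subgroup. *)
Lemma boundary_ge F : F \subset H -> F != set0 -> ~~ (H \subset F :|: boundary F) ->
  (c <= #|boundary F|)%N.
Proof.
move=> sFH nzF nF; have fragF: frag F by apply/and3P.
pose G := [arg min_(G < F | frag G) #|boundary G|].
have [fG minG] : frag G /\ forall F', frag F' -> (#|boundary G| <= #|boundary F'|)%N.
  by rewrite /G; case: arg_minnP.
clearbody G.
apply: leq_trans (minG _ fragF); rewrite leqNgt; apply/negP.
have [k cG] : exists k, #|boundary G| = k by exists #|boundary G|.
rewrite cG in minG *; move=> lt_kc.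
pose fr F' := frag F' && (#|boundary F'| == k).
have [A0 [frA0 minA0]] : exists A0, fr A0 /\ forall F', fr F' -> (#|A0| <= #|F'|)%N.
  have frG : fr G by rewrite /fr fG cG eqxx.
  by exists [arg min_(G' < G | fr G') #|G'|]; case: arg_minnP.
have fr_tr a F' : a \in H -> fr F' -> fr (translate a F').
  move=> Ha /andP[fF' /eqP cF']; rewrite /fr frag_translate // boundary_translate.
  by rewrite card_translate cF' /=.
have frLe F' : frag F' -> (#|boundary F'| <= k)%N -> fr F'.
  by move=> fF' leF'; rewrite /fr fF' eqn_leq leF' minG.
have [A [frA minA A_0]] : exists A, [/\ fr A, forall F', fr F' -> (#|A| <= #|F'|)%N & 0 \in A].
  have /andP[/and3P[sA0 /set0Pn[a A0a] _] _] := frA0.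
  exists (translate a A0); split; last by rewrite inE add0r.
    by apply: fr_tr; rewrite ?(subsetP sA0).
  by rewrite card_translate.
have /andP[fA /eqP cA] := frA; have /and3P[sAH _ nA] := fA.
(* [A] and its translate [B] both contain 0. Once their intersection has boundary at most [k], it is
   no smaller than the atom [A], so [A] is contained in [B]. *)
have AD u a : u \in A -> a \in A -> u + a \in A.
  move=> Au Aa; have Ha := subsetP sAH a Aa.
  have frB := fr_tr a A Ha frA; set B := translate a A in frB *.
  have /andP[/and3P[sBH _ _] /eqP cB] := frB.
  suff /subsetP/(_ u Au) : A \subset B by rewrite inE.
  have fI : frag (A :&: B).
    apply/and3P; split; first by rewrite subIset ?sAH.
      by apply/set0Pn; exists 0; rewrite !inE A_0 add0r.
    apply: contra nA => /subset_trans; apply; apply/subsetP=> v /setUP[/setIP[Av _] | ].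
      by rewrite inE Av.
    by case/boundaryP=> _ [s sS] /setIP[As _]; apply: in_closed_nbhd As.
  have subm := boundary_submodular A B; rewrite cA cB in subm.
  have ltI : (#|boundary (A :&: B)| <= k)%N -> A \subset B.
    move=> leI; have /minA cI := frLe _ fI leI.
    by apply/setIidPl/eqP; rewrite eqEcard subsetIl.
  (* If the union is a fragment, its boundary has at least [k] elements and submodularity bounds
     that of the intersection. Otherwise the union and its boundary cover [H], which has at least
     [2 * #|A| + k] elements; this boundary then exceeds [k], leaving less than [k] for the
     intersection, against minimality. *)
  have [fU | nU] := boolP (frag (A :|: B)).
    apply: ltI; rewrite -(leq_add2r k); apply: leq_trans subm.
    by rewrite leq_add2l minG.
  have [fC subC] := frag_compl fA.
  have leAC : (#|A| <= #|H :\: (A :|: boundary A)|)%N.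
    by apply/minA/frLe => //; rewrite (leq_trans (subset_leq_card subC)) ?cA.
  have HU : H \subset (A :|: B) :|: boundary (A :|: B).
    move: nU; rewrite /frag subUset sAH sBH /= negb_and negbK orbC negbK.
    by case/orP=> // /eqP AB0; have:= in_set0 (0 : V); rewrite -AB0 inE A_0.
  have I_gt0 : (0 < #|A :&: B|)%N by rewrite card_gt0; case/and3P: fI.
  have cAB := cardsUI A B; have cBA : #|B| = #|A| by apply: card_translate.
  have cH := cardsID (A :|: boundary A) H; have cN := cardsUI A (boundary A).
  have I0 : A :&: boundary A = set0.
    by apply/setP=> v; rewrite !inE; case: (v \in A).
  rewrite I0 cards0 (setIidPr _) ?subUset ?sAH ?boundaryH // in cN cH.
  have leH := leq_trans (subset_leq_card HU) (leq_card_setU _ _).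
  have minI := minG _ fI; move: I_gt0 cAB cBA cH cN leAC subm leH minI; rewrite cA; clear.
  move: #|A :&: B| #|A :|: B| #|A| #|B| #|H| #|A :|: boundary A| => i u a0 b h an.
  move: #|boundary (A :&: B)| #|boundary (A :|: B)| #|H :\: _| => ni nu hc. lia.
have trA a : a \in A -> translate a A = A.
  move=> Aa; apply/setP=> v; rewrite inE; apply/idP/idP=> Av; last exact: AD.
  by rewrite -(addrKv v a) AD.
(* [A] is now a subgroup and its boundary a union of [size r] cosets. Every generator lies in [A] or
   in its boundary, so [A] and [r] span [H]. *)
have [|r cr rP] := translate_cover trA A_0 (R := boundary A).
  by move=> a /trA {2}<-; rewrite boundary_translate.
have genA : (2 ^ N <= #|A| * 2 ^ size r)%N.
  apply: leq_trans cardH (leq_trans (subset_leq_card _) (card_extend A r)).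
  have ext_sub : A \subset extend A r.
    elim: (r) => //= x r' IHr; apply: subset_trans IHr (subsetUl _ _).
  apply: genH => [|v s Wv sS]; first exact: (subsetP ext_sub).
  have [As | A's] := boolP (s \in A).
    by apply: extend_closed; rewrite ?As ?orbT.
  have [|x rx Ax] := rP s.
    by apply/boundaryP; split=> //; exists s; rewrite ?addvv.
  rewrite -[v + s](addrKv _ x); apply: extend_closed; rewrite ?rx //.
  by rewrite -addrA; apply: extend_closed; rewrite ?Ax ?orbT.
rewrite cA in cr; have A_gt0 : (0 < #|A|)%N by apply/card_gt0P; exists 0.
(* If [A] is trivial, all of [S] lies in its boundary; if not, [coset_bound] applies. *)
have [A_le1 | A_gt1] := leqP #|A| 1.
  have A1 : #|A| = 1%N by apply/eqP; rewrite eqn_leq A_le1.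
  have defA : A = [set 0].
    by apply/eqP; rewrite eq_sym eqEcard A1 cards1 sub1set A_0.
  move: lt_kc; rewrite ltnNge (leq_trans c_leS) //.
  rewrite -cA; apply/subset_leq_card/subsetP=> s sS; apply/boundaryP.
  rewrite defA inE; split; first by apply: contraNneq S0 => <-.
  by exists s; rewrite // addvv inE.
have r_gt0 : (0 < size r)%N.
  rewrite lt0n; apply/eqP=> r0; case/negP: nA.
  suff: H \subset A by move/subset_trans; apply; apply: subsetUl.
  apply: genH => // v s Av sS; apply: contraLR (sS) => nvs.
  have nA0 : boundary A = set0 by apply: cards0_eq; rewrite cA cr r0.
  suff: v + s \in boundary A by rewrite nA0 inE.
  by apply/boundaryP; split=> //; exists s; rewrite // addrKv.
by move: lt_kc; rewrite ltnNge cr (leq_trans c_leN) // coset_bound.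
Qed.

End Isoperimetry.

(** * Joining links into D-paths *)

Lemma mem_zip (A B : eqType) (s : seq A) (t : seq B) p :
  p \in zip s t -> (p.1 \in s) && (p.2 \in t).
Proof.
elim: s t => [|a s IHs] [|b t] //=; rewrite !inE => /predU1P[-> /= | /IHs/andP[-> ->]].
  by rewrite !eqxx.
by rewrite !orbT.
Qed.

Section PathEdges.

Variable T : finType.
Implicit Types (a b : T) (p q : seq T) (E : {set T}).

Lemma path_edges_nil : path_edges [::] = set0 :> {set {set T}}.
Proof. by apply/setP=> E; rewrite inE; apply/imsetP=> -[]. Qed.

Lemma path_edges1 a : path_edges [:: a] = set0.
Proof. by apply/setP=> E; rewrite inE; apply/imsetP=> -[]. Qed.

Lemma path_edges_cons2 a b p :
  path_edges [:: a, b & p] = [set a; b] |: path_edges (b :: p).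
Proof.
apply/setP=> E; apply/imsetP/setU1P=> [[u] | [-> | /imsetP[u pu ->]]].
- by rewrite inE => /predU1P[-> | pu] ->; [left | right; apply: imset_f].
- by exists (a, b); rewrite ?mem_head.
by exists u; rewrite // inE pu orbT.
Qed.

Lemma path_edges_cat p a q :
  path_edges (p ++ a :: q) = path_edges (rcons p a) :|: path_edges (a :: q).
Proof.
elim: p => [|b p IHp]; first by rewrite /= path_edges1 set0U.
case: p => [|c p] in IHp *.
  by rewrite /= !path_edges_cons2 path_edges1 setU0.
by rewrite /= !path_edges_cons2 IHp setUA.
Qed.

Lemma path_edges_rev p : path_edges (rev p) = path_edges p.
Proof.
elim: p => [|a [|b p] IHp] //.
rewrite path_edges_cons2 -IHp !rev_cons -cats1 cat_rcons path_edges_cat.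
by rewrite path_edges_cons2 path_edges1 setU0 setUC [[set b; a]]setUC.
Qed.

Lemma path_edges_sub p E : E \in path_edges p -> E \subset path_vertices p.
Proof.
elim: p => [|a [|b p] IHp]; rewrite ?path_edges_nil ?path_edges1 ?inE //.
rewrite path_edges_cons2 => /setU1P[-> | /IHp/subset_trans->//].
  by rewrite subUset !sub1set !inE !eqxx orbT.
by apply/subsetP=> c; rewrite !(inE, in_cons) => ->; rewrite orbT.
Qed.

Lemma path_edges_rcons_meet p a E :
  E \in path_edges (rcons p a) -> exists2 b, b \in p & b \in E.
Proof.
elim: p => [|b [|c p] IHp]; first by rewrite path_edges1 inE.
  by rewrite /= path_edges_cons2 path_edges1 setU0 inE => /eqP->; exists b; rewrite ?set21 ?mem_head.
rewrite /= path_edges_cons2 => /setU1P[-> | /IHp[d pd Ed]].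
  by exists b; rewrite ?set21 ?mem_head.
by exists d; rewrite // inE pd orbT.
Qed.

End PathEdges.

Section Assembly.

Variables (T : finType) (e : rel T) (D : {set T}).
Hypothesis e_sym : symmetric e.
Implicit Types (u v w : T) (s t P : seq T).

(** Passes from lists to sets of bounded sequences. A [D]-path has an edge, so no path is disjoint
    from itself in this sense and the list has no repetition. *)
Lemma pi_set_ge (Ps : seq (seq T)) : 1 < #|D| -> all (is_Dpath e D) Ps ->
    pairwise (fun P Q => (path_vertices P :&: path_vertices Q == D) &&
                         (path_edges P :&: path_edges Q == set0)) Ps ->
  size Ps <= pi_set e D.
Proof.
move=> D_gt1 DPs; set R := (X in pairwise X _) => RPs.
have R_sym P Q : R P Q -> R Q P by rewrite /R setIC [_ :&: path_edges Q]setIC.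
have R_irr P : is_Dpath e D P -> ~~ R P P.
  case/andP=> _ DP; rewrite /R !setIid negb_and; apply/orP; right.
  case: P DP => [|a [|b P]] DP.
  - by move: (subset_leq_card DP); rewrite /path_vertices set_nil cards0; lia.
  - have := subset_leq_card DP; rewrite /path_vertices.
    by rewrite (_ : [set _ in _] = [set a]) ?cards1; [lia | apply/setP=> c; rewrite !inE].
  by apply/set0Pn; exists [set a; b]; rewrite path_edges_cons2 setU11.
have UPs : uniq Ps.
  elim: Ps DPs RPs => //= P Ps IHPs /andP[DP DPs] /andP[RP RPs].
  by rewrite IHPs // andbT; apply: contra (R_irr P DP) => /(allP RP).
have sz P : P \in Ps -> size P <= #|T|.
  by case/(allP DPs)/andP=> /and3P[_ UP _] _; rewrite -(card_uniqP UP) max_card.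
pose Qs : seq (#|T|.-bseq T) := pmap insub Ps.
have memQ Q : (Q \in Qs) = ((Q : seq T) \in Ps) by rewrite mem_pmap_sub.
rewrite (_ : size Ps = #|[set Q in Qs]|); last first.
  rewrite cardsE (card_uniqP _) ?pmap_sub_uniq //.
  rewrite size_pmap_sub; apply/esym/eqP; rewrite -all_count.
  by apply/allP=> P /sz.
apply: (@leq_bigmax_cond _ _ (fun S : {set _} => #|S|)).
apply/andP; split; apply/forall_inP=> P; rewrite inE memQ => PsP.
  exact: (allP DPs).
apply/forall_inP=> Q; rewrite inE memQ => PsQ; apply/implyP=> neqPQ.
rewrite -[_ && _]/(R P Q).
have {neqPQ}: (P : seq T) != Q by [].
elim: Ps {DPs UPs sz Qs memQ} RPs PsP PsQ => //= P' Ps IHPs /andP[/allP RP' RPs].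
rewrite !inE => /predU1P[-> | PsP] /predU1P[-> | PsQ]; rewrite ?eqxx //.
- by move=> _; apply: RP'.
- by move=> _; apply/R_sym/RP'.
exact: IHPs.
Qed.

(** A link is represented by its inner vertices; a mere edge is the empty sequence. *)
Definition linked u v s := path e u (rcons s v) && all [predC D] s.

(* A link without inner vertices is recorded by its edge, the only thing two D-paths
   could share. *)
Definition tokens u v s : seq (T + {set T}) :=
  if s is [::] then [:: inr [set u; v]] else [seq inl a | a <- s].

(** Both links start at the middle vertex [v]; [s] is traversed backwards. *)
Definition bent v u w s t := rev (rcons s u) ++ v :: rcons t w.

Lemma tokens_inl u v s a : (inl a \in tokens u v s) = (a \in s).
Proof. by case: s => // b s; rewrite mem_map // => c d []. Qed.

Lemma tokens_inr u v s (E : {set T}) : (inr E \in tokens u v s) = (s == [::]) && (E == [set u; v]).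
Proof. by case: s => [|b s]; rewrite ?inE //; apply/mapP=> -[]. Qed.

Lemma tokens_rev u v s : perm_eq (tokens v u (rev s)) (tokens u v s).
Proof.
case: s => [|b s]; first by rewrite /= setUC.
have ->: tokens v u (rev (b :: s)) = [seq inl a | a <- rev (b :: s)].
  by rewrite rev_cons; case: (rev s).
by rewrite map_rev perm_rev.
Qed.

Lemma linked_rev u v s : linked v u (rev s) = linked u v s.
Proof.
rewrite /linked all_rev; congr (_ && _).
have := rev_path e u (rcons s v); rewrite last_rcons belast_rcons rev_cons => ->.
by apply: eq_path => a b; apply: e_sym.
Qed.

(** Inner vertices are outside [D], and every edge of a link that has inner vertices contains one of
    them. *)
Lemma edge_within_D v w t (E : {set T}) : v \in D -> all [predC D] t ->
  E \subset D -> E \in path_edges (v :: rcons t w) -> t = [::] /\ E = [set v; w].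
Proof.
case: t => [|a t] Dv tD ED.
  by rewrite /= path_edges_cons2 path_edges1 setU0 inE => /eqP.
have tE b : b \in a :: t -> b \notin E.
  by move/(allP tD); apply: contra; apply: subsetP.
rewrite /= path_edges_cons2 => /setU1P[defE | /(@path_edges_rcons_meet _ (a :: t))[b]].
  by have:= tE a; rewrite defE set22 mem_head => /(_ isT).
by move/tE/negPf->.
Qed.

Section Bent.

Variables (v u w : T) (s t : seq T).
Hypotheses (defD : D = [set u; v; w]) (uniqD : uniq [:: u; v; w]).
Hypotheses (link_s : linked v u s) (link_t : linked v w t).

Lemma bent_vertex a : a \in bent v u w s t -> a \notin D ->
  inl a \in tokens v u s ++ tokens v w t.
Proof.
rewrite /bent !mem_cat !tokens_inl mem_rev !(inE, mem_rcons) defD !inE.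
by do 3 case: (_ == _) => //=.
Qed.

Lemma bent_edge (E : {set T}) : E \in path_edges (bent v u w s t) -> E \subset D ->
  inr E \in tokens v u s ++ tokens v w t.
Proof.
have Dv : v \in D by rewrite defD !inE eqxx orbT.
case/andP: link_s => _ sD; case/andP: link_t => _ tD.
rewrite path_edges_cat -rev_cons path_edges_rev mem_cat !tokens_inr => /setUP[] + ED.
  by case/(edge_within_D Dv sD ED) => -> ->; rewrite !eqxx.
by case/(edge_within_D Dv tD ED) => -> ->; rewrite !eqxx orbT.
Qed.

Lemma bent_Dpath : uniq (s ++ t) -> is_Dpath e D (bent v u w s t).
Proof.
move=> Ust; case/andP: link_s => es /allP sD; case/andP: link_t => et /allP tD.
apply/andP; split; last first.
  apply/subsetP=> a aD; rewrite inE /bent mem_cat mem_rev; move: aD; rewrite defD !(inE, mem_rcons).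
  by do 3 case: (_ == _); rewrite ?orbT.
have perm_b : perm_eq (bent v u w s t) ([:: u; v; w] ++ (s ++ t)).
  apply/permP=> p; rewrite /bent count_cat count_rev -!cats1 /= !count_cat /=; lia.
apply/and3P; split; first by rewrite /bent rev_rcons.
  rewrite (perm_uniq perm_b) cat_uniq uniqD Ust andbT; apply/hasPn=> a.
  rewrite mem_cat => sta; have: a \notin D by case/orP: sta => [/sD | /tD].
  by rewrite defD !inE orbA.
rewrite /bent rev_rcons cat_cons -cat_rcons /= cat_path last_rcons et andbT.
by have:= linked_rev v u s; rewrite link_s => /andP[].
Qed.

End Bent.
Lemma uniq_tokens_cat v u w s t :
  uniq (tokens v u s ++ tokens v w t) -> uniq (s ++ t).
Proof.
have sub v' u' s' : subseq [seq inl a | a <- s'] (tokens v' u' s').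
  by case: s' => [|a s']; [apply: sub0seq | apply: subseq_refl].
move/(subseq_uniq (cat_subseq (sub v u s) (sub v w t))).
by rewrite -map_cat; apply: map_uniq.
Qed.

Lemma mem_flatten_tokens_inl u v L a :
  (inl a \in flatten (map (tokens u v) L)) = (a \in flatten L).
Proof. by elim: L => //= s L IHL; rewrite !mem_cat IHL tokens_inl. Qed.

Lemma mem_flatten_tokens_inr u v L (E : {set T}) :
  (inr E \in flatten (map (tokens u v) L)) = ([::] \in L) && (E == [set u; v]).
Proof.
elim: L => //= s L IHL; rewrite !mem_cat IHL tokens_inr inE eq_sym.
by rewrite andb_orl.
Qed.

Lemma uniq_flatten_tokens u v L : uniq (flatten L) -> count_mem [::] L <= 1 ->
  uniq (flatten (map (tokens u v) L)).
Proof.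
elim: L => //= s L IHL; rewrite !cat_uniq => /and3P[Us sL UL] cL.
have {}IHL := IHL UL (leq_trans (leq_addl _ _) cL).
apply/and3P; split=> //.
  by case: (s) Us => // a s' Us; rewrite map_inj_uniq // => b c [].
apply/hasPn=> -[a | E].
  rewrite mem_flatten_tokens_inl tokens_inl => La.
  by apply: contra sL => sa; apply/hasP; exists a.
rewrite mem_flatten_tokens_inr tokens_inr => /andP[L0 _]; apply/negP=> /andP[/eqP s0 _].
by move: cL; rewrite s0 eqxx addSn ltnS leqn0 addn_eq0 => /andP[_ /eqP/count_memPn/negP].
Qed.

Lemma perm_flatten_zip (A B : eqType) (f g : A -> seq B) (L1 L2 : seq A) :
  size L1 = size L2 ->
  perm_eq (flatten [seq f p.1 ++ g p.2 | p <- zip L1 L2])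
          (flatten (map f L1) ++ flatten (map g L2)).
Proof.
elim: L1 L2 => [|a L1 IHL] [|b L2] //= [/IHL{}IHL].
by rewrite -!catA perm_cat2l perm_sym perm_catCA perm_cat2l perm_sym.
Qed.

Lemma perm_flatten_tokens_rev u v L :
  perm_eq (flatten (map (tokens v u) (map rev L))) (flatten (map (tokens u v) L)).
Proof. by elim: L => //= s L IHL; rewrite perm_cat ?tokens_rev. Qed.

(** [r] covers all that [P] must not share with another [D]-path: vertices outside [D] and edges
    within [D]. *)
Definition traces P (r : seq (T + {set T})) :=
  [/\ is_Dpath e D P, forall a, a \in P -> a \notin D -> inl a \in r &
      forall E : {set T}, E \in path_edges P -> E \subset D -> inr E \in r].

(** An edge common to two paths has both ends in common, hence in [D] once the vertices are known to
    meet only there; so disjoint records suffice. *)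
Lemma traces_pi_set (Ps : seq (seq T * seq (T + {set T}))) :
    1 < #|D| -> {in Ps, forall p, traces p.1 p.2} -> uniq (flatten (map snd Ps)) ->
  size Ps <= pi_set e D.
Proof.
move=> D_gt1 tPs UPs; rewrite -(size_map fst); apply: pi_set_ge => //.
  by apply/allP=> _ /mapP[p /tPs[DP _ _] ->].
elim: Ps tPs UPs => //= p Ps IHPs tPs; rewrite cat_uniq => /and3P[_ pPs UPs].
rewrite IHPs // ?andbT => [|q Pq]; last by apply: tPs; rewrite inE Pq orbT.
have disj r c : r \in Ps -> c \in p.2 -> c \in r.2 -> False.
  by move=> Pr pc rc; case/hasP: pPs; exists c => //; apply/flatten_mapP; exists r.
apply/allP=> _ /mapP[q Pq ->]; have [DP aP EP] := tPs p (mem_head _ _).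
have [|DQ aQ EQ] := tPs q; first by rewrite inE Pq orbT.
have defI : path_vertices p.1 :&: path_vertices q.1 = D.
  apply/eqP; rewrite eqEsubset subsetI.
  case/andP: DP => _ ->; case/andP: DQ => _ ->; rewrite !andbT.
  apply/subsetP=> a; rewrite !inE => /andP[pa qa]; apply: contraT => D'a.
  by case: (disj q (inl a) Pq (aP a pa D'a) (aQ a qa D'a)).
rewrite defI eqxx /=; apply/eqP/setP=> E; rewrite in_set0.
apply/negP=> /setIP[pE qE].
have ED : E \subset D by rewrite -defI subsetI !path_edges_sub.
exact: (disj q (inr E) Pq (EP E pE ED) (EQ E qE ED)).
Qed.

Definition block v u w L1 L2 :=
  [seq (bent v u w p.1 p.2, tokens v u p.1 ++ tokens v w p.2) | p <- zip L1 L2].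

Lemma block_traces v u w L1 L2 : D = [set u; v; w] -> uniq [:: u; v; w] ->
    all (linked v u) L1 -> all (linked v w) L2 ->
    uniq (flatten (map snd (block v u w L1 L2))) ->
  {in block v u w L1 L2, forall p, traces p.1 p.2}.
Proof.
move=> defD uniqD lL1 lL2 Ub q.
case/mapP=> -[s t] zst -> /=; have /andP[/(allP lL1) ls /(allP lL2) lt] := mem_zip zst.
have Ust : uniq (s ++ t).
  apply: (@uniq_tokens_cat v u w); move: Ub; rewrite /block -map_comp /comp /=.
  elim: (zip L1 L2) zst => //= p z IHz; rewrite inE cat_uniq => /predU1P[<- | zst].
    by case/andP.
  by case/and3P=> _ _ /IHz->.
split; first exact: bent_Dpath.
  by move=> a; apply: bent_vertex.
by move=> E; apply: bent_edge.
Qed.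

(** Half of the links between [x] and [y] are joined at [x] to links to [z], the other half at [y],
    which gives [k] paths each; the remaining [k - 1] links from [x] and from [y] to [z] are joined
    at [z]. As an edge serves as a link only once, each list has at most one empty link. *)
Lemma linked_pi_set k x y z Lxy Lxz Lyz :
    D = [set x; y; z] -> uniq [:: x; y; z] ->
    size Lxy = (k + k)%N -> size Lxz = (k + k.-1)%N -> size Lyz = (k + k.-1)%N ->
    all (linked x y) Lxy -> all (linked x z) Lxz -> all (linked y z) Lyz ->
    uniq (flatten Lxy ++ flatten Lxz ++ flatten Lyz) ->
    count_mem [::] Lxy <= 1 -> count_mem [::] Lxz <= 1 -> count_mem [::] Lyz <= 1 ->
  k + (k + k.-1) <= pi_set e D.
Proof.
move=> defD uniqD sxy sxz syz lxy lxz lyz UL cxy cxz cyz.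
pose A := block x y z (take k Lxy) (take k Lxz).
pose B := block y x z (map rev (drop k Lxy)) (take k Lyz).
pose C := block z x y (map rev (drop k Lxz)) (map rev (drop k Lyz)).
have D_gt1 : 1 < #|D|.
  rewrite defD (leq_trans (_ : 1 < #|[set x; y]|)) ?subset_leq_card ?subsetUl //.
  by move: uniqD; rewrite cards2 /= inE negb_or -andbA => /and3P[-> _ _].
have all_rev u v L : all (linked u v) L -> all (linked v u) (map rev L).
  by rewrite all_map; apply: sub_all => s; rewrite /= linked_rev.
have all_take (P : pred (seq T)) n L : all P L -> all P (take n L).
  by rewrite -{1}(cat_take_drop n L) all_cat => /andP[].
have all_drop (P : pred (seq T)) n L : all P L -> all P (drop n L).
  by rewrite -{1}(cat_take_drop n L) all_cat => /andP[].
have UT : uniq (flatten (map snd (A ++ B ++ C))).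
  have /perm_uniq-> : perm_eq (flatten (map snd (A ++ B ++ C)))
      (flatten (map (tokens x y) Lxy) ++ flatten (map (tokens x z) Lxz) ++
       flatten (map (tokens y z) Lyz)).
    rewrite !map_cat !flatten_cat.
    have pb v u w L1 L2 : size L1 = size L2 ->
        perm_eq (flatten (map snd (block v u w L1 L2)))
          (flatten (map (tokens v u) L1) ++ flatten (map (tokens v w) L2)).
      by move=> eq_sz; rewrite /block -map_comp; apply: perm_flatten_zip.
    apply/permP=> P; rewrite !count_cat.
    rewrite !(permP (pb _ _ _ _ _ _)) ?count_cat; last first.
    + by rewrite !(size_map, size_take_min, size_drop) sxy sxz; lia.
    + by rewrite !(size_map, size_take_min, size_drop) sxy syz; lia.
    + by rewrite !(size_map, size_take_min, size_drop) sxz syz; lia.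
    rewrite !(permP (perm_flatten_tokens_rev _ _ _)).
    rewrite -{3}(cat_take_drop k Lxy) -{3}(cat_take_drop k Lxz) -{3}(cat_take_drop k Lyz).
    by rewrite !map_cat !flatten_cat !count_cat; lia.
  move: UL; rewrite !cat_uniq !has_cat !negb_or -!andbA.
  case/and5P=> Uxy xy_xz xy_yz Uxz /andP[xz_yz Uyz].
  have disj (u v w t : T) (L L' : seq (seq T)) : [set u; v] != [set w; t] -> ~~ has [in flatten L] (flatten L') ->
      ~~ has [in flatten (map (tokens u v) L)] (flatten (map (tokens w t) L')).
    move=> neq dL; apply/hasPn=> -[a | E].
      by rewrite mem_flatten_tokens_inl /= mem_flatten_tokens_inl; apply: (hasPn dL).
    rewrite mem_flatten_tokens_inr /= mem_flatten_tokens_inr => /andP[_ /eqP->].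
    by rewrite eq_sym (negPf neq) andbF.
  move: uniqD; rewrite /= !inE negb_or -!andbA andbT => /and3P[xy xz yz].
  have neq (u v w t : T) : u \notin [:: w; t] -> [set u; v] != [set w; t].
    move=> u'wt; apply/eqP=> /setP/(_ u); rewrite !inE eqxx.
    by move: u'wt; rewrite !inE => /negPf->.
  rewrite !uniq_flatten_tokens //= !disj //; last first.
  - by rewrite [[set x; y]]setUC neq // !inE negb_or [y == x]eq_sym xy.
  - by rewrite neq // !inE negb_or xy.
  by rewrite neq // !inE negb_or xy.
have [UA UB UC] : [/\ uniq (flatten (map snd A)), uniq (flatten (map snd B))
                   & uniq (flatten (map snd C))].
  move: UT; rewrite !map_cat !flatten_cat !cat_uniq.
  by case/and3P=> -> _ /and3P[-> _ ->].
have -> : k + (k + k.-1) = size (A ++ B ++ C).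
  by rewrite !size_cat /A /B /C /block !size_map !size_zip !size_map !size_take_min !size_drop sxy sxz syz; lia.
have permD u v w : perm_eq [:: u; v; w] [:: x; y; z] ->
    D = [set u; v; w] /\ uniq [:: u; v; w].
  move=> pD; rewrite (perm_uniq pD) uniqD defD; split=> //.
  by apply/setP=> a; have:= perm_mem pD a; rewrite !inE -!orbA => ->.
have [|dA uA] := permD y x z; first by apply/permP=> p /=; rewrite addnCA.
have [|dC uC] := permD x z y.
  by apply/permP=> p; congr (_ + _); rewrite /= addnCA.
apply: traces_pi_set => // p; rewrite !mem_cat => /or3P[].
- by apply: (block_traces dA uA _ _ UA); rewrite all_take.
- by apply: (block_traces defD uniqD _ _ UB); rewrite ?all_take ?all_rev ?all_drop.
by apply: (block_traces dC uC _ _ UC); rewrite ?all_rev ?all_drop.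
Qed.

End Assembly.

(** * Cutting paths on one side and crossing to the other *)

Lemma perm_flatten_cons (A B : eqType) (h : A -> B) (F : A -> seq B) (r : seq A) :
  perm_eq (flatten [seq h a :: F a | a <- r]) (map h r ++ flatten (map F r)).
Proof.
elim: r => //= a r IHr; rewrite perm_cons.
by rewrite (perm_trans (perm_cat (perm_refl _) IHr)) // perm_catCA.
Qed.

(** With at least two elements, the first and the last occupy different positions, so the ends
    together inherit the absence of repetitions from [flatten r]. *)
Lemma subseq_ends (A : eqType) (a b : A) (r : seq (seq A)) :
  all (fun s => 1 < size s) r ->
  exists2 t, perm_eq t (map (head a) r ++ map (last b) r) & subseq t (flatten r).
Proof.
elim: r => [_|s r IHr /= /andP[]]; first by exists [::].
case: s => [|c [|d s]] // _ /IHr[t pt st].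
exists ([:: c; last d s] ++ t).
  by apply/permP=> p; have:= permP pt p; rewrite /= !count_cat /=; lia.
apply: (@cat_subseq _ [:: c; last d s] _ (c :: d :: s)) st.
by apply: (@cat_subseq _ [:: c] _ [:: c]); rewrite sub1seq ?mem_last ?mem_head.
Qed.

(** Bounds the paths that cannot be cut: a single inner vertex cannot serve both [x] and [y]. *)
Lemma size_short_paths (T : finType) (L : seq (seq T)) (C : {set T}) : uniq (flatten L) ->
    (forall s, s \in L -> size s = 1 -> all [in C] s) ->
  size [seq s <- L | size s == 1] <= #|C|.
Proof.
move=> UL LC; have sz: size (flatten [seq s <- L | size s == 1]) =
    size [seq s <- L | size s == 1].
  by elim: L {UL LC} => //= s L IHL; case: ifP => //= /eqP sz; rewrite size_cat sz IHL.
have Uf : uniq (flatten [seq s <- L | size s == 1]).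
  elim: L UL {LC sz} => //= s L IHL; rewrite cat_uniq => /and3P[Us sL /IHL UL].
  case: ifP => //= _; rewrite cat_uniq Us UL andbT; apply: contra sL.
  case/hasP=> v /flattenP[t]; rewrite mem_filter => /andP[_ Lt] tv sv.
  by apply/hasP; exists v => //; apply/flattenP; exists t.
rewrite -sz cardE; apply: uniq_leq_size => // v /flattenP[s].
rewrite mem_filter => /andP[/eqP sz1 Ls] sv.
by rewrite mem_enum; apply: (allP (LC s Ls sz1)).
Qed.

Section Split.

Variables (T : finType) (e : rel T).
Hypotheses (e_sym : symmetric e) (e_irr : irreflexive e).
Implicit Types (U : {set T}) (x y z : T) (s : seq T) (L : seq (seq T)).

(** Each cut path leaves one vertex next to [x] and one next to [y]. With [x] and [y] themselves
    these are [2 * (2 * k - 1) = 4 * k - 2] vertices, as many as a fan on the other side admits. *)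
Lemma split_pi_set k U (g : T -> T) x y z : 0 < k ->
    expanding e U (4 * k - 2) -> expanding e (~: U) (4 * k - 2) ->
    injective g -> (forall v, e v (g v)) -> {in U, forall v, g v \notin U} ->
    x \in U -> y \in U -> z \notin U -> x != y ->
    e x y + #|[set v in U | e x v && e v y]| <= 2 * k ->
  k + (k + k.-1) <= pi_set e [set x; y; z].
Proof.
move=> k_gt0 expU expU' g_inj eg gU Ux Uy U'z xy le_short.
have [L [szL UL LP]] := local_paths e_sym e_irr expU Ux Uy xy.
have short : size [seq s <- L | size s == 1] <= #|[set v in U | e x v && e v y]|.
  apply: size_short_paths => // s /LP[_]; case: s => [|v []] //= /and3P[exv evy _].
  by rewrite !inE exv evy => /andP[/andP[_ ->] _].
pose long s := size s != 1.
(* There are [4 * k - 2 - e x y] paths, of which at most [2 * k - e x y] are short. *)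
have szlong : 2 * k - 2 <= size (filter long L).
  have := count_predC (fun s => size s == 1) L; rewrite -!size_filter.
  by rewrite [X in _ + size X](_ : _ = filter long L) //; lia.
pose Lg := take (2 * k - 2) (filter long L).
pose Lk := drop (2 * k - 2) (filter long L) ++ [seq s <- L | size s == 1].
have pL : perm_eq (Lg ++ Lk) L.
  rewrite catA cat_take_drop perm_catC.
  by rewrite -[filter long L](@eq_filter _ (predC (fun s => size s == 1))) // perm_filterC.
have szLg : size Lg = 2 * k - 2 by rewrite size_takel.
have szLk : size Lk = 2 * k - e x y.
  by have := perm_size pL; rewrite size_cat szL szLg; case: (e x y) => /=; lia.
have memLg s : s \in Lg -> s \in L by rewrite -(perm_mem pL) mem_cat => ->.
have memLk s : s \in Lk -> s \in L by move=> ks; rewrite -(perm_mem pL) mem_cat ks orbT.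
have long_g : all (fun s => 1 < size s) Lg.
  apply/allP=> s gs; have [+ _ _] := LP s (memLg s gs); move: gs => /mem_take.
  by rewrite mem_filter /long => /andP[+ _]; case: s => // a [].
(* [E0] consists of the ends of the cut paths. *)
have [E0 pE sE] := subseq_ends x y long_g.
have UE : uniq (E0 ++ flatten Lk).
  have : uniq (flatten (Lg ++ Lk)) by rewrite (perm_uniq (perm_flatten pL)).
  rewrite flatten_cat; apply: subseq_uniq; exact: cat_subseq sE (subseq_refl _).
have inU v : v \in flatten L -> v \in U :\: [set x; y].
  by case/flattenP=> s /LP[_ _ /allP sU] /sU.
have EU v : v \in E0 -> v \in U :\: [set x; y].
  move/(mem_subseq sE)/flattenP=> [s /memLg Ls sv]; apply: inU.
  by apply/flattenP; exists s.
pose hs := (x :: map (head x) Lg) ++ (y :: map (last y) Lg).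
have phs : perm_eq hs ([:: x; y] ++ E0).
  rewrite /hs /= perm_cons -cat1s perm_catCA /= perm_cons perm_sym.
  exact: pE.
have U_hs : uniq hs.
  rewrite (perm_uniq phs) cat_uniq /= !inE xy /=.
  move: UE; rewrite cat_uniq => /and3P[-> _ _]; rewrite andbT.
  by apply/hasPn=> v /EU; rewrite !inE negb_or => /andP[].
have hsU : all [in U] hs.
  apply/allP=> v; rewrite (perm_mem phs) !inE => /or3P[/eqP->|/eqP->|/EU] //.
  by rewrite !inE => /andP[].
have [||||F [UF F0 FP]] := fan expU' (z := z) (Z := map g hs).
- by rewrite inE.
- by rewrite map_inj_uniq.
- by apply/allP=> _ /mapP[v /(allP hsU) Uv ->]; rewrite inE gU.
- rewrite size_map size_cat /= !size_map szLg.
  by move: k_gt0; clear; lia.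
(* The edge from [x] to [y], if present, brings the kept paths to [2 * k]. A link to [z] crosses
   over at [x] or [y] itself, or one step later at the end of a cut path. *)
pose Lxy := Lk ++ nseq (e x y) [::].
pose Lxz := F (g x) :: [seq head x s :: F (g (head x s)) | s <- Lg].
pose Lyz := F (g y) :: [seq last y s :: F (g (last y s)) | s <- Lg].
have ZP v : v \in hs -> all [in ~: U :\ z] (F (g v)) /\
    forall u, e u (g v) -> path e u (rcons (F (g v)) z).
  by move=> hv; apply: FP; apply: map_f.
set D := [set x; y; z].
have DU v : v \in U :\: [set x; y] -> v \notin D.
  rewrite !inE => /andP[/negPf-> Uv] /=; apply: contraNneq U'z => <- //.
have DF v w : v \in hs -> w \in F (g v) -> w \notin D.
  case/ZP=> /allP FU _ /FU; rewrite !inE => /andP[/negPf-> U'w].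
  by rewrite orbF negb_or; apply/andP; split; apply: contraNneq U'w => ->.
have hx : x \in hs by rewrite mem_head.
have hy : y \in hs by rewrite mem_cat mem_head orbT.
have hh s : s \in Lg -> head x s \in hs.
  by move=> gs; rewrite mem_cat inE map_f ?orbT.
have hl s : s \in Lg -> last y s \in hs.
  by move=> gs; rewrite mem_cat !inE map_f ?orbT.
have Eh s : s \in Lg -> head x s \in E0.
  by move=> gs; rewrite (perm_mem pE) mem_cat map_f.
have El s : s \in Lg -> last y s \in E0.
  by move=> gs; rewrite (perm_mem pE) mem_cat orbC map_f.
apply: (@linked_pi_set _ e D e_sym k x y z Lxy Lxz Lyz) => //.
- rewrite /= !inE negb_or xy andbT; apply/andP; split.
    by apply: contraNneq U'z => <-.
  by apply: contraNneq U'z => <-.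
- rewrite size_cat szLk size_nseq subnK; first by rewrite addnn mul2n.
  by apply: leq_trans (leq_b1 _) _; rewrite muln_gt0.
- by rewrite /= size_map szLg; move: k_gt0; clear; lia.
- by rewrite /= size_map szLg; move: k_gt0; clear; lia.
- rewrite all_cat; apply/andP; split.
    apply/allP=> s /memLk/LP[_ es /allP sU]; rewrite /linked es.
    by apply/allP=> v /sU; apply: DU.
  by case exy: (e x y) => //=; rewrite /linked /= exy.
- rewrite /= /linked (ZP x hx).2 //=; apply/andP; split.
    by apply/allP=> w; apply: DF.
  apply/allP=> _ /mapP[s gs ->]; have [] := LP s (memLg s gs).
  have /DU := EU _ (Eh s gs); have := hh s gs; case: s gs => //= a s gs ha D'a _.
  by case/andP=> -> _ _; rewrite (ZP a ha).2 //= D'a; apply/allP=> w; apply: DF.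
- rewrite /= /linked (ZP y hy).2 //=; apply/andP; split.
    by apply/allP=> w; apply: DF.
  apply/allP=> _ /mapP[s gs ->]; have [_ es _] := LP s (memLg s gs).
  have /DU := EU _ (El s gs); have := hl s gs; set b := last y s => hb D'b.
  have lx : last x s = b by have := allP long_g s gs; rewrite /b; case: (s).
  have eyb : e y b by move: es; rewrite rcons_path lx e_sym => /andP[].
  by rewrite /= eyb (ZP b hb).2 //= D'b; apply/allP=> w; apply: DF.
(* The inner vertices of all links are the ends of the cut paths, the kept paths and the fan. *)
- have /perm_uniq -> : perm_eq (flatten Lxy ++ flatten Lxz ++ flatten Lyz)
      ((E0 ++ flatten Lk) ++ flatten (map F (map g hs))).
    apply/permP=> p; have cE := permP pE p; rewrite count_cat in cE.
    have cL h := permP (perm_flatten_cons h (fun s => F (g (h s))) Lg) p.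
    have eF h v : count p (flatten (map F (map g (v :: map h Lg)))) =
        count p (F (g v)) + count p (flatten [seq F (g (h s)) | s <- Lg]).
      by rewrite !map_cons -!map_comp; apply: count_cat.
    have eL h v : count p (flatten (F (g v) :: [seq h s :: F (g (h s)) | s <- Lg])) =
        count p (F (g v)) + (count p (map h Lg) + count p (flatten [seq F (g (h s)) | s <- Lg])).
      by rewrite -(count_cat p (map h Lg)) -cL; apply: count_cat.
    rewrite /hs !map_cat (flatten_cat (map F _)) (count_cat p (E0 ++ _)).
    rewrite (count_cat p E0) cE (count_cat p (flatten (map F _))).
    rewrite (count_cat p (flatten Lxy)) (count_cat p (flatten Lxz)).
    rewrite (eF (head x)) (eF (last y)) (eL (head x)) (eL (last y)) /Lxy flatten_cat.
    have -> : flatten (nseq (e x y) [::]) = [::] :> seq T by case: (e x y).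
    rewrite cats0; move: (count p) => cp; clear.
    move: (cp (F (g x))) (cp (F (g y))) (cp (flatten Lk)) (cp (flatten _)) (cp (map (head x) Lg)) => a b c d f.
    by move: (cp (flatten _)) (cp (map _ _)); lia.
  rewrite cat_uniq UE UF andbT; apply/hasPn=> w /flatten_mapP[t /mapP[v hv ->]].
  case/ZP: hv => /allP FU _ /FU; rewrite !inE => /andP[_ U'w].
  rewrite mem_cat negb_or; apply/andP; split.
    by apply: contra U'w => /EU; rewrite inE => /andP[].
  apply: contra U'w => /flattenP[s /memLk Ls sw].
  have /inU : w \in flatten L by apply/flattenP; exists s.
  by rewrite inE => /andP[].
- have k0 : count_mem [::] Lk = 0 by apply/count_memPn/negP=> /memLk/LP[].
  by rewrite count_cat k0 count_nseq /= mul1n leq_b1.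
- have h0 : count_mem [::] [seq head x s :: F (g (head x s)) | s <- Lg] = 0.
    by apply/count_memPn/mapP=> -[].
  by rewrite /= h0 addn0 leq_b1.
have l0 : count_mem [::] [seq last y s :: F (g (last y s)) | s <- Lg] = 0.
  by apply/count_memPn/mapP=> -[].
by rewrite /= l0 addn0 leq_b1.
Qed.

End Split.

(** * The augmented cube as a Cayley graph *)

Definition xor_seq (s t : seq bool) := [seq p.1 (+) p.2 | p <- zip s t].

Section BitStrings.

Variable n : nat.
Implicit Types x y : n.-tuple bool.

Definition xor_tuple x y : n.-tuple bool := [tuple of xor_seq x y].

Lemma tnth_xor x y i : tnth (xor_tuple x y) i = tnth x i (+) tnth y i.
Proof.
rewrite !(tnth_nth false) /= (nth_map (false, false)) ?nth_zip ?size_tuple //.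
Qed.

Lemma xor_tupleA : associative xor_tuple.
Proof. by move=> x y z; apply: eq_from_tnth => i; rewrite !tnth_xor addbA. Qed.

Lemma xor_tupleC : commutative xor_tuple.
Proof. by move=> x y; apply: eq_from_tnth => i; rewrite !tnth_xor addbC. Qed.

Lemma xor_tuple0 : left_id [tuple of nseq n false] xor_tuple.
Proof.
by move=> x; apply: eq_from_tnth => i; rewrite tnth_xor (tnth_nth false) nth_nseq if_same.
Qed.

Lemma xor_tuplexx : left_inverse [tuple of nseq n false] id xor_tuple.
Proof.
move=> x; apply: eq_from_tnth => i.
by rewrite tnth_xor (tnth_nth false [tuple of nseq _ _]) nth_nseq if_same addbb.
Qed.

HB.instance Definition _ := GRing.isZmodule.Build (n.-tuple bool)
  xor_tupleA xor_tupleC xor_tuple0 xor_tuplexx.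

End BitStrings.


Lemma addvv n (x : n.-tuple bool) : (x + x = 0)%R.
Proof. exact: xor_tuplexx. Qed.

Lemma val_addv n (x y : n.-tuple bool) : val (x + y)%R = xor_seq x y.
Proof. by []. Qed.

(** Each leading position has a hypercubic and a complementary generator, which coincide in the last
    position; hence [2 * n - 1] in all for positive [n]. *)
Fixpoint gens n : seq (seq bool) :=
  if n is m.+1 then
    (if m is 0 then [:: [:: true]] else [:: true :: nseq m false; true :: nseq m true])
      ++ map (cons false) (gens m)
  else [::].

Lemma mem_gens_false m s : (false :: s \in gens m.+1) = (s \in gens m).
Proof.
have inj : injective (cons false) by move=> ? ? [].
by rewrite /= mem_cat mem_map //; case: m.
Qed.

Lemma mem_gens_true m s :
  (true :: s \in gens m.+1) = (s == nseq m false) || (s == nseq m true).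
Proof.
have nf : (true :: s) \in map (cons false) (gens m) = false by apply/mapP=> -[].
by rewrite /= mem_cat nf orbF; case: m {nf} => [|m]; rewrite !inE //= orbb.
Qed.

Lemma gens_uniq m : uniq (gens m).
Proof.
elim: m => // m IHm; rewrite cat_uniq map_inj_uniq ?IHm ?andbT; last by move=> ? ? [].
apply/andP; split; first by case: m {IHm}.
by apply/hasPn=> _ /mapP[s _ ->]; case: m {IHm}.
Qed.

Lemma size_gens m : size (gens m.+1) = m.*2.+1.
Proof. by elim: m => // m IHm; rewrite /= size_map IHm. Qed.

Lemma size_mem_gens m s : s \in gens m -> size s = m.
Proof.
elim: m s => // m IHm [|[] s]; first by rewrite mem_cat => /orP[|/mapP[]] //; case: m {IHm}.
  by rewrite mem_gens_true => /orP[] /eqP->; rewrite /= size_nseq.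
by rewrite mem_gens_false => /IHm /= ->.
Qed.

Lemma xor_seq_cons a s b t : xor_seq (a :: s) (b :: t) = a (+) b :: xor_seq s t.
Proof. by []. Qed.

Lemma xor_seq_eq0 s t : size s = size t -> (xor_seq s t == nseq (size s) false) = (t == s).
Proof.
elim: s t => [|a s IHs] [|b t] // [/IHs{}IHs]; rewrite xor_seq_cons [nseq _ _]/= !eqseq_cons -IHs.
by case: a b => [] [] /=.
Qed.

Lemma xor_seq_eq1 s t : size s = size t ->
  (xor_seq s t == nseq (size s) true) = (t == map negb s).
Proof.
elim: s t => [|a s IHs] [|b t] // [/IHs{}IHs]; rewrite xor_seq_cons [nseq _ _]/= [map _ _]/= !eqseq_cons -IHs.
by case: a b => [] [] /=.
Qed.

(** Equal leading bits cancel in the sum; after the first difference, the rest of the sum must be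
    all zeros or all ones. *)
Lemma augmented_cubeE n (x y : n.-tuple bool) :
  augmented_cube x y = (xor_seq x y \in gens n).
Proof.
elim: n => [|[|n] IHn] in x y *; first by rewrite tuple0 (tuple0 y).
  case/tupleP: x => a x; case/tupleP: y => b y; rewrite (tuple0 x) (tuple0 y) /= -val_eqE /=.
  by case: a b => [] [].
rewrite augmented_cubeSS IHn; case/tupleP: x => a x; case/tupleP: y => b y.
rewrite !theadE -!val_eqE [LHS]/=.
have sz : size x = size y by rewrite !size_tuple.
have:= xor_seq_eq0 sz; have:= xor_seq_eq1 sz; rewrite size_tuple => <- <-.
case: eqVneq => [-> | ]; first by rewrite xor_seq_cons addbb mem_gens_false.
by rewrite -negb_add negbK => ab; rewrite xor_seq_cons ab mem_gens_true.
Qed.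

(* Coordinates in the basis of the suffixes of ones: there the generators are the unit
   vectors and the sums of two consecutive unit vectors. *)
Definition coord (j : nat) (s : seq bool) := nth false (false :: s) j (+) nth false s j.

Lemma coordS j a s : coord j.+2 (a :: s) = coord j.+1 s.
Proof. by []. Qed.

Lemma coord_cons_false j s : coord j.+1 (false :: s) = coord j s.
Proof. by []. Qed.

Lemma coord_nseq j m b : j < m -> coord j (nseq m b) = (j == 0) && b.
Proof. by rewrite /coord; case: j => [|j] ltjm; rewrite /= ?nth_nseq ?ltjm ?(ltnW ltjm) ?addbb //; case: m ltjm. Qed.

Lemma gensSS m : gens m.+2 =
  [:: true :: nseq m.+1 false; true :: nseq m.+1 true] ++ map (cons false) (gens m.+1).
Proof. by []. Qed.

(** Coordinate [j] is moved only by the unit vector [u_j] and its sums with the neighbouring unit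
    vectors; for [j = 0] there is no predecessor. *)
Lemma count_coord_gens m j : j < m -> count (coord j) (gens m) <= 3 - (j == 0).
Proof.
elim: m j => // -[_ [|j] // | m IHm] j ltjm; rewrite gensSS count_cat count_map.
case: j ltjm => [_ | j ltjm].
  have c0 : preim (cons false) (coord 0) =1 pred0 by [].
  by rewrite (eq_count c0) count_pred0.
rewrite (eq_count (coord_cons_false j)).
case: j ltjm => [|j] ltjm; first by rewrite (leq_add2l 1) (IHm 0).
have ltj1 : j.+1 < m.+1 by [].
have cf := coord_nseq false ltj1; have ct := coord_nseq true ltj1.
rewrite /= in cf ct.
by rewrite [count _ [:: _; _]]/= !coordS cf ct; apply: IHm.
Qed.

Lemma expanding_preim (T : finType) (e : rel T) (h : T -> T) (U : {set T}) c :
    involutive h -> (forall u v, e (h u) (h v) = e u v) ->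
  expanding e U c -> expanding e (h @^-1: U) c.
Proof.
move=> hK eh [degU expU]; have h_inj := inv_inj hK.
have card_h (F : {set T}) : #|h @^-1: F| = #|F|.
  exact: card_preimset.
split=> [x Ux | F sFU nzF nF].
  rewrite inE in Ux; apply: leq_trans (degU _ Ux) _.
  rewrite -card_h; apply/subset_leq_card/subsetP=> v; rewrite !inE.
  by rewrite eh.
have eqF : F = h @^-1: (h @^-1: F) by apply/setP=> v; rewrite !inE hK.
have nb : nbrs e (h @^-1: U) F = h @^-1: nbrs e U (h @^-1: F).
  apply/setP=> v; rewrite !inE hK; congr (_ && _).
  apply/existsP/existsP=> -[w]; rewrite ?inE => /andP[Fw ewv]; exists (h w).
    by rewrite inE hK Fw eh.
  by rewrite Fw -eh hK.
rewrite nb card_h; apply: expU.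
- by apply/subsetP=> v; rewrite inE => /(subsetP sFU); rewrite inE hK.
- by apply: contraNneq nzF => F0; rewrite eqF F0 preimset0.
apply: contra nF => /subsetP UF; apply/subsetP=> v; rewrite inE => /UF.
by rewrite nb !in_setU !inE !hK.
Qed.

Section Cube.

Variable n : nat.
Local Notation V := (n.-tuple bool).
Local Notation aq := (@augmented_cube n).
Implicit Types (v w x y z : V) (j : nat).

Definition gen_set : {set V} := [set v : V | (v : seq bool) \in gens n].

Definition side j b : {set V} := [set v : V | coord j v == b].

Lemma aqE x y : aq x y = ((x + y)%R \in gen_set).
Proof. by rewrite augmented_cubeE inE. Qed.

Lemma card_gens (P : pred (seq bool)) :
  #|[set v in gen_set | P v]| = count P (gens n).
Proof.
have U : uniq (filter P (gens n)) by rewrite filter_uniq ?gens_uniq.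
pose r : seq V := pmap insub (filter P (gens n)).
have -> : [set v in gen_set | P v] = [set v in r].
  by apply/setP=> v; rewrite !inE mem_pmap_sub mem_filter andbC.
rewrite cardsE (card_uniqP _) ?pmap_sub_uniq // size_pmap_sub.
rewrite (@eq_in_count _ _ predT) ?count_predT ?size_filter // => s.
by rewrite mem_filter => /andP[_ /size_mem_gens->]; rewrite eqxx.
Qed.

Lemma card_gen_set : 0 < n -> #|gen_set| = 2 * n - 1.
Proof.
move=> n_gt0; rewrite (_ : gen_set = [set v in gen_set | predT (v : seq bool)]).
  by rewrite card_gens count_predT -(prednK n_gt0) size_gens; lia.
by apply/setP=> v; rewrite [in RHS]inE andbT.
Qed.

Lemma coordD j x y : coord j (x + y)%R = coord j x (+) coord j y.
Proof.
have nth_xor s t i : size s = size t ->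
    nth false (xor_seq s t) i = nth false s i (+) nth false t i.
  by elim: s t i => [|a s IHs] [|b t] [|i] //= [/IHs].
have nxy i : nth false (x + y)%R i = nth false x i (+) nth false y i.
  by apply: nth_xor; rewrite !size_tuple.
by case: j => [|j]; rewrite /coord /= !nxy //= addbACA.
Qed.

Lemma coord_eq0 v : (forall j, j < n -> coord j v = false) -> v = 0%R.
Proof.
move=> v0; have nv j : j < n -> nth false v j = false.
  elim: j => [|j IHj] ltjn; have:= v0 _ ltjn; rewrite /coord //=.
  by rewrite (IHj (ltnW ltjn)).
apply/val_inj/(@eq_from_nth _ false); first by rewrite !size_tuple.
by move=> i; rewrite size_tuple => lti; rewrite nv // nth_nseq lti.
Qed.

Lemma neq_coord x y : x != y -> exists2 j, j < n & coord j x != coord j y.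
Proof.
move=> neq; have [/existsP[j cj] | /existsPn eqc] :=
    boolP [exists j : 'I_n, coord j x != coord j y]; first by exists j.
case/eqP: neq; rewrite -[x](@addrKv _ (@addvv n) _ y).
rewrite (@coord_eq0 (x + y)%R) ?add0r // => j ltjn.
by have:= eqc (Ordinal ltjn); rewrite negbK coordD => /eqP->; rewrite addbb.
Qed.

Lemma unit_vector i : i < n ->
  exists2 u : V, u \in gen_set & forall j, j < n -> coord j u = (j == i).
Proof.
move=> ltin; pose s := nseq i false ++ nseq (n - i) true.
have sz : size s == n by rewrite size_cat !size_nseq subnKC // ltnW.
exists (Tuple sz) => [|j ltjn]; rewrite ?inE /=.
  rewrite /s {sz s}; elim: (n) i ltin => // m IHm [|i] ltin.
    by rewrite subn0 /= mem_gens_true eqxx orbT.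
  by rewrite /= mem_gens_false subSS IHm.
have ns l : l < n -> nth false s l = (i <= l).
  move=> ltl; rewrite nth_cat size_nseq !nth_nseq; case: ltnP => // leil.
  by rewrite ltn_sub2r // (leq_ltn_trans leil).
rewrite /coord ns //; case: j ltjn => [|j] ltjn /=; first by case: (i).
by rewrite ns ?(ltnW ltjn) //; lia.
Qed.

Lemma aq_translate w x y : aq (w + x)%R (w + y)%R = aq x y.
Proof. by rewrite !aqE addrACA addvv add0r. Qed.

Lemma gen0 : 0%R \notin gen_set.
Proof. by rewrite -(addvv (0%R : V)) -aqE augmented_cube_irr. Qed.

(** At most three of the [2 * n - 1] generators leave the hyperplane, so [2 * n - 4] remain. This
    equals [2 * (n.-1).-1], the bound that [boundary_ge] allows for a group of order [2 ^ n.-1]. The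
    other side is a translate. *)
Lemma expanding_side j b : 2 < n -> j < n -> expanding aq (side j b) (2 * n - 4).
Proof.
move=> n_gt2 ltjn; have [u Su cu] := unit_vector ltjn.
suff exp0 : expanding aq (side j false) (2 * n - 4).
  case: b => //; rewrite (_ : side j true = (fun v => u + v)%R @^-1: side j false).
    apply: expanding_preim exp0 => [v | v w]; first by rewrite addrA addvv add0r.
    exact: aq_translate.
  by apply/setP=> v; rewrite !inE coordD cu // eqxx; case: (coord j v).
set H := side j false; pose S := gen_set :&: H.
have memH v : (v \in H) = ~~ coord j v by rewrite inE eqbF_neg.
have cS : 2 * n - 4 <= #|S|.
  have := cardsID H gen_set; rewrite card_gen_set ?(leq_trans _ n_gt2) //.
  have -> : gen_set :\: H = [set v in gen_set | coord j v].
    by apply/setP=> v; rewrite in_setD memH negbK [in RHS]inE andbC.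
  by rewrite card_gens; have := count_coord_gens ltjn; rewrite -/S; lia.
have HD v w : v \in H -> w \in H -> (v + w)%R \in H.
  by rewrite !memH coordD => /negPf-> /negPf->.
have cH : 2 ^ n.-1 <= #|H|.
  have := cardsID H [set: V]; rewrite cardsT card_tuple card_bool setTI.
  have -> : [set: V] :\: H = translate u H.
    by apply/setP=> v; rewrite !inE coordD cu // eqxx; case: (coord j v).
  rewrite (card_translate (@addvv n)) => c2.
  by rewrite -(leq_pmul2l (isT : 0 < 2)) -expnS (ltn_predK ltjn) -c2 mul2n addnn.
have genH (F : {set V}) : 0%R \in F ->
    (forall v s, v \in F -> s \in S -> (v + s)%R \in F) -> H \subset F.
  move=> F0 FS; apply/subsetP=> v Hv.
  (* The hyperplane is spanned by the unit vectors other than [u_j]: induction on the number [m] of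
     leading coordinates that may be nonzero. *)
  suff FH m : m <= n -> forall w, w \in H ->
      (forall l, m <= l < n -> coord l w = false) -> w \in F.
    by apply: (FH n) Hv _ => // l /andP[]; rewrite leqNgt => /negP.
  elim: m => [_ w _ w0 | m IHm ltmn w Hw wm]; first by rewrite (coord_eq0 w0).
  have {}IHm := IHm (ltnW ltmn).
  have [cm | c'm] := boolP (coord m w); last first.
    apply: IHm => // l; rewrite leq_eqVlt => /andP[/predU1P[<- _ | ltml ltln]].
      exact: negbTE.
    by apply: wm; rewrite ltml.
  have [t St ct] := unit_vector ltmn.
  have jm : (j == m) = false by apply: contraTF Hw => /eqP eq_jm; rewrite memH negbK eq_jm.
  have Ht : t \in H by rewrite memH ct // jm.
  rewrite -(addrKv (@addvv n) w t); apply: FS; last by rewrite inE St.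
  apply: IHm; first exact: HD.
  move=> l; rewrite leq_eqVlt => /andP[/predU1P[<- _ | ltml ltln]].
    by rewrite coordD cm ct // eqxx.
  by rewrite coordD (wm l) ?ltml // ct // eqn_leq [l <= m]leqNgt ltml.
split=> [x Hx | F sFH nzF nF].
  apply: leq_trans cS _; rewrite -(card_imset (mem S) (addrI x)).
  apply/subset_leq_card/subsetP=> _ /imsetP[s /setIP[Ss Hs] ->].
  by rewrite inE HD // aqE addrA addvv add0r.
have nbE : nbrs aq H F = boundary S F.
  apply/setP=> v; rewrite inE in_setD.
  apply/andP/boundaryP=> [[/andP[F'v Hv] /existsP[w /andP[Fw wv]]] | ].
    split=> //; exists (w + v)%R; last by rewrite addrCA addvv addr0.
    by rewrite in_setI -aqE wv HD // (subsetP sFH).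
  case=> F'v [s /setIP[Ss Hs] Fvs].
  have Hv : v \in H by rewrite -(addrKv (@addvv n) v s) HD // (subsetP sFH).
  rewrite F'v Hv; split=> //; apply/existsP; exists (v + s)%R.
  by rewrite Fvs aqE addrAC addvv add0r.
rewrite nbE in nF *.
have SH : S \subset H by apply: subsetIr.
have S0 : 0%R \notin S by rewrite in_setI negb_and gen0.
have cN : 2 * n - 4 <= 2 * (n.-1).-1 by move: n_gt2; clear; lia.
exact: (boundary_ge (@addvv n) HD SH S0 genH cH cS cN sFH nzF nF).
Qed.
End Cube.

(** * The lower bound by splitting along a coordinate *)

Section Lower.

Variable n : nat.
Local Notation V := (n.-tuple bool).
Local Notation aq := (@augmented_cube n).
Implicit Types (v w x y z : V) (j k : nat).

Lemma aq_irr x : aq x x = false. Proof. exact: augmented_cube_irr. Qed.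
Lemma aq_sym : symmetric aq. Proof. exact: augmented_cube_sym. Qed.

(* Of the two edges joining a common neighbour to x and y, exactly one moves a
   coordinate m separating x from y, and only three generators move m. *)
Lemma short_paths_le6 (U : {set V}) x y : x != y ->
  aq x y + #|[set v in U | aq x v && aq v y]| <= 6.
Proof.
move=> neq; have [m ltmn cm] := neq_coord neq.
have cxy : coord m (x + y)%R by rewrite coordD addbC -negb_eqb eq_sym.
pose M := [set s in gen_set n | coord m s].
have cM : #|M| <= 3.
  by rewrite card_gens (leq_trans (count_coord_gens ltmn)) ?leq_subr.
pose M' := M :\ (x + y)%R.
have cM' : aq x y + #|M'| <= 3.
  by rewrite (leq_trans _ cM) // (cardsD1 (x + y)%R M) leq_add2r inE -aqE cxy andbT.
pose C w := [set v : V | (w + v)%R \in M'].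
have inC w v : (v \in C w) = ((w + v)%R \in M') by rewrite /C in_set.
have cC w : #|C w| = #|M'|.
  rewrite -(card_imset _ (addrI w)); apply: eq_card => s.
  apply/imsetP/idP => [[v] | Ms]; first by rewrite inC => ? ->.
  by exists (w + s)%R; [rewrite inC|]; rewrite addrA addvv add0r.
have sub : [set v in U | aq x v && aq v y] \subset C x :|: C y.
  apply/subsetP=> v; rewrite inE => /and3P[_ xv vy].
  have y'v : v != y by apply: contraTneq vy => ->; rewrite aq_irr.
  have x'v : v != x by apply: contraTneq xv => ->; rewrite aq_irr.
  have inM w : aq w v -> coord m w (+) coord m v -> (w + v)%R \in M.
    by rewrite in_set -aqE coordD => ->.
  rewrite in_setU !inC !in_setD1 (inj_eq (addrI x)) [in (y + v)%R == _](addrC x).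
  rewrite (inj_eq (addrI y)) x'v y'v /=.
  have yv : aq y v by rewrite aq_sym.
  case cv: (coord m x (+) coord m v); first by rewrite inM.
  rewrite (inM y) ?orbT //; move: cxy cv; rewrite coordD.
  by case: (coord m x); case: (coord m y); case: (coord m v).
have := leq_trans (subset_leq_card sub) (leq_card_setU _ _); rewrite !cC.
by move: cM'; clear; case: (aq x y); lia.
Qed.

(** Translation by the unit vector [u_j] is the injection between the two sides, and
    [2 * n - 4 = 4 * k - 2]. *)
Lemma pi_set_split k j x y z : n = k.*2.+1 -> 1 < k -> j < n ->
    coord j x = coord j y -> coord j x != coord j z -> x != y ->
    aq x y + #|[set v in side n j (coord j x) | aq x v && aq v y]| <= 2 * k ->
  k + (k + k.-1) <= pi_set aq [set x; y; z].
Proof.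
move=> def_n k_gt1 ltjn cxy cxz neq le_short.
have [u Su cu] := unit_vector ltjn.
have n_gt2 : 2 < n by rewrite def_n; move: k_gt1; clear; lia.
have def_c : 2 * n - 4 = 4 * k - 2 by rewrite def_n; clear; lia.
have expU b := expanding_side b n_gt2 ltjn; rewrite def_c in expU.
have sideC b : ~: side n j b = side n j (~~ b).
  by apply/setP=> v; rewrite !inE; case: b (coord j v) => -[].
apply: (split_pi_set aq_sym aq_irr (ltnW k_gt1) (U := side n j (coord j x))
          (g := fun v => (u + v)%R)) => //.
- by rewrite sideC.
- exact: addrI.
- by move=> v; rewrite aqE addrCA addvv addr0.
- by move=> v; rewrite !inE coordD cu // eqxx => /eqP->; case: (coord j x).
- by rewrite inE.
- by rewrite inE cxy.
by rewrite inE eq_sym.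
Qed.

(** Coordinates are bits, so one that separates [x] from [y] puts [z] on the side of exactly one of
    them; and [6 <= 2 * k]. *)
Lemma pi_set_ge3 k x y z : n = k.*2.+1 -> 2 < k -> uniq [:: x; y; z] ->
  k + (k + k.-1) <= pi_set aq [set x; y; z].
Proof.
move=> def_n k_gt2 Uxyz.
have le6 (U : {set V}) v w : v != w -> aq v w + #|[set t in U | aq v t && aq t w]| <= 2 * k.
  by move/(short_paths_le6 U)/leq_trans; apply; move: k_gt2; clear; lia.
move: Uxyz; rewrite /= !inE negb_or andbT => /andP[/andP[xy xz] yz].
have [j ltjn cxy] := neq_coord xy.
have [cxz | cxz] := eqVneq (coord j x) (coord j z).
  rewrite (_ : [set x; y; z] = [set x; z; y]); last first.
    by rewrite -!setUA [[set y] :|: _]setUC.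
  exact: (pi_set_split def_n (ltnW k_gt2) ltjn cxz cxy xz (le6 _ _ _ xz)).
have cyz : coord j y = coord j z.
  by move: cxy cxz; case: (coord j x) (coord j y) (coord j z) => -[] [].
rewrite (_ : [set x; y; z] = [set y; z; x]); last by rewrite -!setUA setUC setUA.
apply: (pi_set_split def_n (ltnW k_gt2) ltjn cyz _ yz (le6 _ _ _ yz)).
by rewrite eq_sym.
Qed.

End Lower.

(** * Dimension five *)

Lemma set3_perm (T : finType) (a b c : T) :
  [/\ [set a; b; c] = [set b; a; c], [set a; b; c] = [set a; c; b],
      [set a; b; c] = [set b; c; a], [set a; b; c] = [set c; a; b] &
      [set a; b; c] = [set c; b; a]].
Proof. by split; apply/setP=> t; rewrite !inE; do 3 case: (_ == _). Qed.

(** By translation only the sum [w] of the two vertices matters; stated on plain lists, the number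
    can be computed. *)
Definition num_short_paths n j w :=
  (w \in gens n) + count (fun s => ~~ coord j s && (xor_seq s w \in gens n)) (gens n).

Lemma num_short_pathsE n j (x y : n.-tuple bool) :
  augmented_cube x y +
    #|[set v in side n j (coord j x) | augmented_cube x v && augmented_cube v y]| =
  num_short_paths n j (x + y)%R.
Proof.
rewrite /num_short_paths augmented_cubeE; congr (_ + _).
pose P s := ~~ coord j s && (xor_seq s (x + y)%R \in gens n).
rewrite -(card_gens n P) -[RHS](card_imset _ (addrI x)); apply: eq_card => v.
have memP (s : n.-tuple bool) : P s = ~~ coord j s && ((s + (x + y))%R \in gen_set n).
  by rewrite [in RHS]inE.
apply/idP/imsetP=> [| [s Gs ->]].
  rewrite !in_set !aqE => /and3P[/eqP cv xv vy]; exists (x + v)%R; last first.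
    by rewrite addrA addvv add0r.
  by rewrite in_set xv memP coordD cv addbb /= addrACA addvv add0r.
have /and3P[gs cs gsxy] : [&& s \in gen_set n, ~~ coord j s & (s + (x + y))%R \in gen_set n].
  by move: Gs; rewrite in_set memP.
rewrite in_set !aqE in_set coordD addrA addvv add0r gs (negPf cs) addbF eqxx /=.
by rewrite -addrA addrCA.
Qed.

(** The triple is translated to 0, [w1], [w2]. Some coordinate must isolate one of the three, while
    the other two have at most [2 * k = 4] short links on their side. *)
Definition separable5 w1 w2 :=
  has (fun j =>
    [|| [&& ~~ coord j w1, coord j w2 & num_short_paths 5 j w1 <= 4],
        [&& ~~ coord j w2, coord j w1 & num_short_paths 5 j w2 <= 4] |
        [&& ~~ coord j (xor_seq w1 w2), coord j w1 &
            num_short_paths 5 j (xor_seq w1 w2) <= 4]])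
    (iota 0 5).

Fixpoint bit_strings n : seq (seq bool) :=
  if n is m.+1 then map (cons false) (bit_strings m) ++ map (cons true) (bit_strings m)
  else [:: [::]].

Lemma mem_bit_strings s : s \in bit_strings (size s).
Proof.
elim: s => //= b s IHs; rewrite mem_cat; case: b; apply/orP; [right | left].
  by apply: map_f.
by apply: map_f.
Qed.

Definition bits5 a b c d f : 5.-tuple bool := [tuple a; b; c; d; f].
(** In the basis belonging to [coord], [u1] and [u3] are the unit vectors 1 and 3, and [u13] is
    their sum. *)
Definition u1 := bits5 false true true true true.
Definition u3 := bits5 false false false true true.
Definition u13 := bits5 false true true false false.

(** The ordered pairs of distinct nonzero elements of the subgroup spanned by [u1] and [u3]. With 0
    added, each is a translate of the triple 0, [u1], [u3]. *)
Definition exceptional5 : seq (seq bool * seq bool) :=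
  [:: (tval u1, tval u3); (tval u3, tval u1); (tval u1, tval u13);
      (tval u13, tval u1); (tval u3, tval u13); (tval u13, tval u3)].

Lemma separable5P : all (fun w1 => all (fun w2 =>
    [|| w1 == nseq 5 false, w2 == nseq 5 false, w1 == w2, separable5 w1 w2 |
      (w1, w2) \in exceptional5])
  (bit_strings 5)) (bit_strings 5).
Proof. by vm_compute. Qed.

Section DimensionFive.

Local Notation aq := (@augmented_cube 5).
Implicit Types (t u v w x y z : 5.-tuple bool).

(* Inner vertices of the links between 0, u1 and u3, found by computer search. *)
Definition links01 : seq (seq (5.-tuple bool)) :=
  [:: [::]; [:: bits5 true true true true true];
      [:: bits5 false true false false false]; [:: bits5 true false false false false]].
Definition links03 : seq (seq (5.-tuple bool)) :=
  [:: [:: bits5 false false true false false]; [:: bits5 false false false true false]; [::]].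
Definition links13 : seq (seq (5.-tuple bool)) :=
  [:: [:: bits5 false true false true true]; [:: bits5 false true true false false];
      [:: bits5 false false true true true]].

Lemma pi_set_exceptional5 t : 5 <= pi_set aq [set t; (t + u1)%R; (t + u3)%R].
Proof.
pose T (s : seq (5.-tuple bool)) := [seq (t + v)%R | v <- s].
have tI := @addrI _ t.
set D := [set _; _; _].
pose ok x y s := path (fun v w : 5.-tuple bool => xor_seq v w \in gens 5) x (rcons s y) &&
  all (fun v => v \notin [:: 0%R; u1; u3]) s.
have linkedT x y L : all (ok x y) L -> all (linked aq D (t + x)%R (t + y)%R) (map T L).
  move=> okL; rewrite all_map; apply: sub_all okL => s /andP[xsy sD] /=.
  rewrite /linked /T -map_rcons path_map; apply/andP; split.
    apply: sub_path xsy => v w vw.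
    suff: aq (t + v)%R (t + w)%R by [].
    by rewrite aq_translate augmented_cubeE.
  have t0 v : ((t + v)%R == t) = (v == 0%R) by rewrite -{2}[t]addr0 (inj_eq tI).
  rewrite all_map; apply: sub_all sD => v; rewrite inE => vD.
  suff: (t + v)%R \notin D by [].
  by rewrite /D !in_setU !in_set1 t0 !(inj_eq tI) -!orbA; move: vD; rewrite !inE.
have linked0 y L : all (ok 0%R y) L -> all (linked aq D t (t + y)%R) (map T L).
  by move/linkedT; rewrite addr0.
have flatT L : flatten (map T L) = T (flatten L) by rewrite /T map_flatten.
(* For [k = 2], four, three and three links are required; they are checked at 0 and translated by
   [t]. *)
apply: (@linked_pi_set _ aq D (@aq_sym 5) 2 t (t + u1)%R (t + u3)%R
          (map T links01) (map T links03) (map T links13)) => //.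
- have : uniq (T [:: 0%R; u1; u3]) by rewrite map_inj_uniq.
  by rewrite /T !map_cons addr0.
- by apply: linked0; vm_compute.
- by apply: linked0; vm_compute.
- by apply: linkedT; vm_compute.
by rewrite !flatT -!map_cat map_inj_uniq.
Qed.

Lemma pi_set_ge5 x y z : uniq [:: x; y; z] -> 5 <= pi_set aq [set x; y; z].
Proof.
rewrite /= !inE negb_or andbT => /andP[/andP[xy xz] yz].
have in_bits (v : 5.-tuple bool) : val v \in bit_strings 5.
  by have:= mem_bit_strings v; rewrite size_tuple.
have := allP (allP separable5P _ (in_bits (x + y)%R)) _ (in_bits (x + z)%R).
have neq0 v w : v != w -> (val (v + w)%R == nseq 5 false :> seq bool) = false.
  move=> vw; apply: contraNF vw => /eqP vw0; rewrite -[v](addrKv (@addvv 5) v w).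
  by rewrite (_ : (v + w)%R = 0%R) ?add0r //; apply: val_inj.
rewrite !neq0 // val_eqE (inj_eq (addrI x)) (negPf yz) !orFb => /orP[].
  case/hasP=> j; rewrite mem_iota => /andP[_ ltj5].
  have split5 u v w : (coord j (u + v)%R = false) -> coord j (u + w)%R -> u != v ->
      num_short_paths 5 j (u + v)%R <= 4 -> 5 <= pi_set aq [set u; v; w].
    rewrite !coordD => cuv cuw uv le4.
    have ecuv : coord j u = coord j v by move: cuv; case: (coord j u) (coord j v) => -[].
    apply: (@pi_set_split 5 2 j) => //; last by rewrite num_short_pathsE.
    by move: cuw; case: (coord j u) (coord j w) => -[].
  case/or3P=> /and3P[].
  - by move/negPf=> c1 c2 le4; apply: split5.
  - by move/negPf=> c1 c2 le4; have [_ -> _ _ _] := set3_perm x y z; apply: split5.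
  rewrite -val_addv (_ : (x + y + (x + z))%R = (y + z)%R); last first.
    by rewrite addrACA addvv add0r.
  move=> /negPf c1 c2 le4.
  by have [_ _ -> _ _] := set3_perm x y z; apply: split5; rewrite // addrC.
have def13 : u13 = (u1 + u3)%R by apply: val_inj.
have [a def_y] : exists a, y = (x + a)%R.
  by exists (x + y)%R; rewrite addrA addvv add0r.
have [b def_z] : exists b, z = (x + b)%R.
  by exists (x + z)%R; rewrite addrA addvv add0r.
(* Pairs involving [u13] are brought to the base point [x + u1] or [x + u3]. *)
rewrite {}def_y {}def_z !addrA addvv !add0r !inE !xpair_eqE !val_eqE.
case/or4P=> [||| /or3P[]] /andP[/eqP-> /eqP->]; rewrite ?def13 ?addrA.
- exact: pi_set_exceptional5.
- have [_ -> _ _ _] := set3_perm x (x + u3)%R (x + u1)%R; exact: pi_set_exceptional5.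
- have [-> _ _ _ _] := set3_perm x (x + u1)%R (x + u1 + u3)%R.
  rewrite -[X in [set _; X; _]](addrKv (@addvv 5) x u1); exact: pi_set_exceptional5.
- have [_ _ _ -> _] := set3_perm x (x + u1 + u3)%R (x + u1)%R.
  rewrite -[X in [set _; X; _]](addrKv (@addvv 5) x u1); exact: pi_set_exceptional5.
- rewrite [(x + u1 + u3)%R]addrAC.
  have [_ _ -> _ _] := set3_perm x (x + u3)%R (x + u3 + u1)%R.
  rewrite -[X in [set _; _; X]](addrKv (@addvv 5) x u3); exact: pi_set_exceptional5.
rewrite [(x + u1 + u3)%R]addrAC.
have [_ _ _ _ ->] := set3_perm x (x + u3 + u1)%R (x + u3)%R.
rewrite -[X in [set _; _; X]](addrKv (@addvv 5) x u3); exact: pi_set_exceptional5.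
Qed.

End DimensionFive.

(** * The upper bound *)

Section UpperBound.

Variables (T : finType) (e : rel T).
Hypotheses (e_sym : symmetric e) (e_irr : irreflexive e).
Implicit Types (a b : T) (P : seq T).

Lemma path_edges_nth a0 P (E : {set T}) :
  reflect (exists2 i, i.+1 < size P & E = [set nth a0 P i; nth a0 P i.+1])
          (E \in path_edges P).
Proof.
elim: P => [|a [|b P] IHP].
- by rewrite path_edges_nil inE; right=> -[].
- by rewrite path_edges1 inE; right=> -[].
rewrite path_edges_cons2; apply: (iffP setU1P) => [[-> | /IHP[i lti eqE]] | [[|i] lti eqE]].
- by exists 0.
- by exists i.+1.
- by left.
by right; apply/IHP; exists i.
Qed.

Lemma set2_cases a b c d : [set a; b] = [set c; d] -> a != b ->
  a = c /\ b = d \/ a = d /\ b = c.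
Proof.
move=> eq_ab neq; have ca : a = c \/ a = d by apply/set2P; rewrite -eq_ab set21.
have cb : b = c \/ b = d by apply/set2P; rewrite -eq_ab set22.
case: ca cb => [ac | ad] [bc | bd]; [| by left | by right |].
  by rewrite ac bc eqxx in neq.
by rewrite ad bd eqxx in neq.
Qed.

Lemma path_edges_adjacent P a b : sorted e P -> [set a; b] \in path_edges P -> a != b ->
  e a b.
Proof.
move=> eP /(path_edges_nth a)[i lti eq_ab] neq.
have ei : e (nth a P i) (nth a P i.+1) by move/(sortedP a): eP; apply.
move: (nth a P i) (nth a P i.+1) ei eq_ab => c d ecd eq_ab.
by case: (set2_cases eq_ab neq) => -[-> ->] //; rewrite e_sym.
Qed.

Lemma path_edges_nbr a0 P a b : uniq P -> [set a; b] \in path_edges P -> a != b ->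
  a \in [:: nth a0 P (index b P).+1; nth a0 P (index b P).-1].
Proof.
move=> UP /(path_edges_nth a0)[i lti eq_ab] neq.
case: (set2_cases eq_ab neq) => -[-> ->]; rewrite index_uniq ?(ltnW lti) //.
  by rewrite !inE eqxx orbT.
by rewrite mem_head.
Qed.

(** The pairs are ordered: an edge with both ends in [D] counts once from each end. *)
Definition path_incidences (D : {set T}) P :=
  [set u : T * T | (u.1 \in D) && ([set u.1; u.2] \in path_edges P)].

(* Every vertex of D but the last one has a successor on the path, and every one
   but the first has a predecessor. *)
Lemma card_path_incidences D P : is_Dpath e D P -> 2 * (#|D| - 1) <= #|path_incidences D P|.
Proof.
case/andP=> /and3P[nzP UP eP] sDP; case: P => // a0 P in nzP UP eP sDP *.
set p := a0 :: P in nzP UP eP sDP *.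
pose next d := (d, nth a0 p (index d p).+1).
pose prev d := (d, nth a0 p (index d p).-1).
have Dp d : d \in D -> d \in p by move/(subsetP sDP); rewrite inE.
have sub_next : next @: (D :\ last a0 P) \subset path_incidences D p.
  apply/subsetP=> _ /imsetP[d /setD1P[d_last Dd] ->]; rewrite inE /= Dd.
  apply/(path_edges_nth a0); exists (index d p); last by rewrite nth_index ?Dp.
  have := Dp d Dd; rewrite -index_mem leq_eqVlt ltnS => /predU1P[eq_i | //].
  case/eqP: d_last; rewrite -[last _ _](last_cons a0) -/p -nth_last -eq_i /=.
  by rewrite nth_index ?Dp.
have sub_prev : prev @: (D :\ a0) \subset path_incidences D p.
  apply/subsetP=> _ /imsetP[d /setD1P[d_first Dd] ->]; rewrite inE /= Dd.
  have i_gt0 : 0 < index d p by rewrite /p /= eq_sym (negPf d_first).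
  apply/(path_edges_nth a0); exists (index d p).-1; rewrite prednK ?index_mem ?Dp //.
  by rewrite nth_index ?Dp // setUC.
have disj : [disjoint next @: (D :\ last a0 P) & prev @: (D :\ a0)].
  apply/pred0P=> u /=; apply/andP=> -[/imsetP[d /setD1P[d_last Dd] ->]].
  case/imsetP=> d' /setD1P[d_first Dd'] eq_u; have eq_d : d = d' := congr1 fst eq_u.
  have /eqP : nth a0 p (index d p).+1 = nth a0 p (index d' p).-1 := congr1 snd eq_u.
  rewrite -{}eq_d in d_first {eq_u} *.
  have i_gt0 : 0 < index d p by rewrite /p /= eq_sym (negPf d_first).
  have lti : (index d p).+1 < size p.
    have := Dp d Dd; rewrite -index_mem leq_eqVlt ltnS => /predU1P[eq_i | //].
    case/eqP: d_last; rewrite -[last _ _](last_cons a0) -/p -nth_last -eq_i /=.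
    by rewrite nth_index ?Dp.
  rewrite nth_uniq // ?(leq_ltn_trans (leq_pred _)) ?index_mem ?Dp //.
  by move: i_gt0; clear; case: (index d p) => // i _; rewrite /= -addn2 -{2}[i]addn0 eqn_add2l.
have cD d : #|D| - 1 <= #|D :\ d| by rewrite (cardsD1 d D); case: (d \in D); lia.
have := subset_leq_card (introT subUsetP (conj sub_next sub_prev)).
rewrite cardsU (disjoint_setI0 disj) cards0 subn0 !card_imset; try by move=> ? ? [].
by apply: leq_trans; rewrite mul2n -addnn leq_add.
Qed.

Lemma pi_set_le (D W : {set T}) r : #|D| = 3 ->
    {in D, forall d, #|[set v | e d v]| <= r} ->
    {in W & D, forall w d, e d w} ->
  4 * pi_set e D + #|W| <= 3 * r.
Proof.
move=> D3 degD WD; pose Inc := [set u : T * T | (u.1 \in D) && e u.1 u.2].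
have cInc : #|Inc| <= 3 * r.
  rewrite -sum1_card (eq_bigl (fun u => (u.1 \in D) && e u.1 u.2)); last first.
    by move=> u; rewrite inE.
  rewrite -(pair_big_dep (mem D) (fun a b => e a b) (fun _ _ => 1)) /= -D3 -sum_nat_const.
  by apply: leq_sum => d /degD; rewrite sum1dep_card.
suff bound S : internally_disjoint_Dpaths e D S -> 4 * #|S| + #|W| <= #|Inc|.
  have leWI : #|W| <= #|Inc|.
    apply: leq_trans (bound set0 _); first by rewrite cards0.
    by apply/andP; split; apply/forall_inP=> P; rewrite inE.
  have : pi_set e D <= (#|Inc| - #|W|) %/ 4.
    by apply/bigmax_leqP=> S /bound; rewrite leq_divRL // mulnC; clear; lia.
  by rewrite leq_divRL //; move: cInc leWI; clear; lia.
case/andP=> /forall_inP DS /forall_inP iS.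
have {}iS (P Q : #|T|.-bseq T) : P \in S -> Q \in S -> P != Q ->
    path_vertices P :&: path_vertices Q = D /\ path_edges P :&: path_edges Q = set0.
  move=> SP SQ neq; have /forall_inP/(_ Q SQ) := iS P SP.
  by rewrite neq => /andP[/eqP-> /eqP->].
have W'D w : w \in W -> w \notin D.
  by move=> Ww; apply/negP=> /(WD w w Ww); rewrite e_irr.
pose U := [set u in Inc | [forall P in S, u \notin path_incidences D P]].
(* If all three pairs at [w] were used, then, as paths meet only in [D], a single path would use
   them; but [w] has at most two neighbours on it. *)
have leWU : #|W| <= #|U|.
  apply: leq_trans (leq_imset_card snd U); apply/subset_leq_card/subsetP=> w Ww.
  apply: contraT => nw.
  have hit d : d \in D -> exists2 P, P \in S & (d, w) \in path_incidences D P.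
    move=> Dd; have : (d, w) \notin U by apply: contra nw => /(imset_f snd).
    rewrite !inE /= Dd (WD w d Ww Dd) /= => /forall_inPn[P SP]; rewrite negbK.
    by exists P.
  have [d0 D0] : exists d0, d0 \in D by apply/card_gt0P; rewrite D3.
  have [P0 SP0] := hit d0 D0; rewrite inE => /andP[_ /path_edges_sub/subsetP wP0].
  have {}wP0 : w \in path_vertices P0 by apply: wP0; rewrite set22.
  suff /subset_leq_card : D \subset [set nth d0 P0 (index w P0).+1; nth d0 P0 (index w P0).-1].
    by rewrite D3 cards2; case: (_ != _).
  apply/subsetP=> d Dd; have [P SP] := hit d Dd; rewrite inE => /andP[_ /= dw].
  have wP : w \in path_vertices P by apply: (subsetP (path_edges_sub dw)); rewrite set22.
  have eq_P : P = P0.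
    apply: contraTeq (W'D w Ww) => /(iS _ _ SP SP0)[<- _].
    by rewrite negbK inE wP.
  have neq : d != w by apply: contraNneq (W'D w Ww) => <-.
  have /andP[/and3P[_ UP _] _] := DS P SP; rewrite -eq_P.
  by have := path_edges_nbr d0 UP dw neq; rewrite !inE.
have sub_Inc (P : #|T|.-bseq T) : P \in S -> path_incidences D P \subset Inc :\: U.
  move=> SP; apply/subsetP=> -[d v] dv; rewrite inE; apply/andP; split.
    by rewrite inE negb_and; apply/orP; right; apply/forall_inPn; exists P; rewrite ?negbK.
  move: dv; rewrite !inE => /andP[-> /= dv].
  have /andP[/and3P[_ UP eP] _] := DS P SP; apply: (path_edges_adjacent _ dv) => //.
  apply: contraTneq (dv) => <-; apply/negP=> /(path_edges_nth d)[i lti /setP eq_d].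
  have := eq_d (nth d P i); have := eq_d (nth d P i.+1).
  rewrite !inE !eqxx orbT !orbb => /eqP e1 /eqP e2.
  have := nth_uniq d (ltnW lti) lti UP; rewrite e1 e2 eqxx => /esym/eqP.
  by clear; lia.
have ge4 (P : #|T|.-bseq T) : P \in S -> 4 <= #|path_incidences D P|.
  by move=> /DS/card_path_incidences; rewrite D3.
have le1 u : #|[set P in S | u \in path_incidences D P]| <= 1.
  apply/card_le1_eqP=> P Q; rewrite !in_set => /andP[SP uP] /andP[SQ uQ].
  apply/eqP; apply: contraT => neq.
  have [_ /setP/(_ [set u.1; u.2])] := iS Q P SQ SP neq.
  by rewrite in_setI (andP uP).2 (andP uQ).2 in_set0.
have : \sum_(P in S) #|path_incidences D P| <= #|Inc :\: U|.
  have -> : \sum_(P in S) #|path_incidences D P| =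
      \sum_(P in S) \sum_(u in Inc :\: U | u \in path_incidences D P) 1.
    apply: eq_bigr => P SP; rewrite sum1dep_card; apply: eq_card => u.
    rewrite [RHS]inE; case: (boolP (u \in path_incidences D P)); rewrite ?andbF // andbT.
    by move/(subsetP (sub_Inc P SP)).
  rewrite (exchange_big_dep (mem (Inc :\: U))) /=; last by move=> P u _ /andP[].
  rewrite -[leqRHS]sum1_card; apply: leq_sum => u Iu; apply: leq_trans (le1 u).
  rewrite sum1dep_card; apply/subset_leq_card/subsetP=> P; rewrite !in_set.
  by case/and3P=> -> _.
have : \sum_(P in S) 4 <= \sum_(P in S) #|path_incidences D P| by apply: leq_sum.
rewrite sum_nat_const => /leq_trans/[apply].
have := subset_leq_card (subsetIl Inc U); rewrite cardsD.
have -> : Inc :&: U = U by apply/setIidPr/subsetP=> u; rewrite inE => /andP[].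
by move: leWU; clear; lia.
Qed.

End UpperBound.

(** * The extremal triple and the conclusion *)

Definition pad m a b c : (m + 3).-tuple bool := [tuple of nseq m false ++ [:: a; b; c]].

Lemma pad_inj m a b c a' b' c' :
  (pad m a b c == pad m a' b' c') = ([:: a; b; c] == [:: a'; b'; c']).
Proof. by rewrite -val_eqE /= eqseq_cat // eqxx. Qed.

(** The common leading zeros cancel, so padding embeds the three-dimensional cube as an induced
    subgraph. *)
Lemma augmented_cube_pad m a b c a' b' c' :
  augmented_cube (pad m a b c) (pad m a' b' c') =
  (xor_seq [:: a; b; c] [:: a'; b'; c'] \in gens 3).
Proof.
rewrite augmented_cubeE [val _]/= /pad /=.
elim: m => // m IHm; rewrite -IHm; exact: mem_gens_false.
Qed.

(* The four vertices of odd weight in the last three bits are common neighbours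
   of the four vertices of even weight. *)
Lemma pi_set_even_triple m :
  exists2 D : {set (m + 3).-tuple bool}, #|D| = 3 &
    4 * pi_set (@augmented_cube (m + 3)) D + 4 <= 3 * (2 * (m + 3) - 1).
Proof.
pose D := [:: pad m false false false; pad m false true true; pad m true true false].
pose W := [:: pad m false false true; pad m false true false; pad m true false false;
              pad m true true true].
have cD : #|[set v in D]| = 3.
  by rewrite cardsE; apply/card_uniqP; rewrite /= !inE !pad_inj.
have cW : #|[set v in W]| = 4.
  by rewrite cardsE; apply/card_uniqP; rewrite /= !inE !pad_inj.
exists [set v in D]; rewrite // -[X in _ + X <= _]cW.
apply: pi_set_le => //; first exact: aq_sym; first exact: aq_irr.
  move=> d _; rewrite -(card_gen_set (n := m + 3)) ?addn3 //.
  rewrite -(card_imset (mem (gen_set _)) (GRing.addrI d)).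
  apply/subset_leq_card/subsetP=> v; rewrite inE aqE => dv.
  by apply/imsetP; exists (d + v)%R; rewrite // GRing.addrA addvv GRing.add0r.
move=> w d; rewrite inE => Ww; rewrite inE => Dd; move: Ww Dd; rewrite !inE.
by case/or4P=> /eqP-> /or3P[] /eqP->; rewrite augmented_cube_pad.
Qed.

Lemma set_of_three (T : finType) (D : {set T}) : #|D| = 3 ->
  exists x y z, uniq [:: x; y; z] /\ D = [set x; y; z].
Proof.
move=> D3; have := enum_uniq D; have : size (enum D) = 3 by rewrite -cardE.
case def_D: (enum D) => [|x [|y [|z []]]] // _ U; exists x, y, z; split=> //.
by apply/setP=> v; rewrite -mem_enum def_D !inE orbA.
Qed.

Theorem corollary1 (n : nat) (n_ge4 : 4 <= n) (n_odd : odd n) :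
  path_connectivity (@augmented_cube n) 3 = 3 * (n - 1) %/ 2 - 1.
Proof.
have [k def_n k_gt1] : exists2 k, n = k.*2.+1 & 1 < k.
  by exists n./2; lia.
have -> : 3 * (n - 1) %/ 2 - 1 = k + (k + k.-1) by lia.
have [|[D cD def_pi] min_le] := @path_connectivity_min _ (@augmented_cube n) 3.
  rewrite card_tuple card_bool; apply: (@leq_trans (2 ^ 4)) => //.
  by rewrite leq_exp2l.
apply/eqP; rewrite eqn_leq; apply/andP; split; last first.
  rewrite def_pi.
  have [x [y [z [Uxyz ->]]]] := set_of_three cD.
  have [k_gt2 | k_le2] := ltnP 2 k; first exact: pi_set_ge3.
  have k2 : k = 2 by lia.
  by rewrite {}k2 in def_n *; subst n; apply: pi_set_ge5.
(* With [n = 2 * k + 1] the bound reads [4 * pi + 4 <= 12 * k + 3], and integrality gives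
   [pi <= 3 * k - 1]. *)
have := pi_set_even_triple (n - 3); rewrite subnK ?(ltnW n_ge4) // => -[D0 /min_le leD0].
by move: leD0 def_n k_gt1; clear; lia.
Qed.
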